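(* For all $\lambda\in\mathbb{R}$ with $\lambda<\lambda_{\mathrm{D},\infty}$, $$N_{\mathrm{N}}(\lambda)=N_{\mathrm{D}}(\lambda)+n_{\mathrm{D}}(\lambda)+\dim G_\lambda^-.$$
   Context: Setting. $H$ is an infinite dimensional separable complex Hilbert space with inner product $(\cdot,\cdot)$ and norm $\|\cdot\|$. $H^1$ is a dense subspace of $H$, $\mathbf{a}[\cdot]$ is a closed positive quadratic form on $H^1$ with sesquilinear form $\mathbf{a}[\cdot,\cdot]$, and $H^1$ is considered as a Hilbert space with the inner product $\mathbf{a}[\cdot,\cdot]$ (in particular $\mathbf{a}[u]\geq c\|u\|^2$ for some $c>0$). $A_{\mathrm{N}}$ is the self-adjoint operator in $H$ generated by $\mathbf{a}$. $H_0^1$ is a closed subspace of $H^1$ which is dense in $H$, and $A_{\mathrm{D}}$ is the self-adjoint operator in $H$ generated by the restriction of $\mathbf{a}$ to $H_0^1$. For $\mathrm{B}\in\{\mathrm{N},\mathrm{D}\}$, $\sigma_{\mathrm{ess}}(A_{\mathrm{B}})$ is the essential spectrum and $\chi_\Lambda(A_{\mathrm{B}})$ is the spectral projection for a Borel set $\Lambda\subset\mathbb{R}$. Notation. $\lambda_{\mathrm{B},\infty}:=\inf\sigma_{\mathrm{ess}}(A_{\mathrm{B}})$ (equal to $+\infty$ if the essential spectrum is empty). $N_{\mathrm{B}}(\lambda):=\dim\chi_{(-\infty,\lambda)}(A_{\mathrm{B}})H$ is the counting function. $E_{\mathrm{B}}(\lambda)$ is the $H$-orthogonal projection onto $\ker(A_{\mathrm{B}}-\lambda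 I)$. $\mathcal{H}_0$ is the subspace of $H$ spanned by all common eigenvectors of $A_{\mathrm{N}}$ and $A_{\mathrm{D}}$, $\mathcal{H}$ is the $H$-orthogonal complement of $\mathcal{H}_0$, and $n_{\mathrm{B}}(\lambda):=\dim E_{\mathrm{B}}(\lambda)\mathcal{H}$. $H_A^1$ is the set of $u\in H^1$ such that the functional $v\mapsto\mathbf{a}[u,v]$ on $H_0^1$ is $H$-continuous, and $A:H_A^1\to H$ is the operator such that $(Au,v)=\mathbf{a}[u,v]$ for all $v\in H_0^1$. For $\lambda\in\mathbb{R}$, $G_\lambda:=\{u\in H_A^1: Au=\lambda u\}$, which is a closed subspace of $H^1$. $\Pi'_\lambda$ is the $H^1$-orthogonal projection onto $G_\lambda$, and $\mathcal{B}_\lambda:=(I-\lambda\Pi'_\lambda A_{\mathrm{N}}^{-1})|_{G_\lambda}$, considered as an operator in the Hilbert space $G_\lambda$ with inner product $\mathbf{a}[\cdot,\cdot]$; it is the bounded self-adjoint operator in $G_\lambda$ satisfying $\mathbf{a}[\mathcal{B}_\lambda u,v]=\mathbf{a}[u,v]-\lambda(u,v)$ for all $u,v\in G_\lambda$. $G_\lambda^-:=\chi_{(-\infty,0)}(\mathcal{B}_\lambda)G_\lambda$, the image of the spectral projection of $\mathcal{B}_\lambda$ corresponding to $(-\infty,0)$. Dimensions may take the value $\infty$. *)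

(* Defs.v *)
From HB Require Import structures.
From mathcomp Require Import all_boot all_order all_algebra.
From mathcomp Require Export sesquilinear.
From mathcomp Require Export complex.
From mathcomp Require Import all_classical all_reals all_analysis.

Set Implicit Arguments.
Unset Strict Implicit.
Unset Printing Implicit Defensive.

Import Order.TTheory GRing.Theory Num.Theory.
Import numFieldNormedType.Exports.

Local Open Scope classical_set_scope.
Local Open Scope ring_scope.
Local Open Scope complex_scope.

(* Conventions.  Subspaces of H are sets of vectors.  A sesquilinear form on a
   subspace V is a function H -> H -> R[i], linear in its first argument, whose
   values are meaningful only for arguments in V.  A linear operator (possibly
   unbounded, possibly acting in a subspace) is given by its graph:
   T u f means "u is in the domain of T and T u = f". *)

Section LinearAlgebra.
Variables (R : realType) (H : lmodType R[i]).
Implicit Types (V K S : set H) (b : H -> H -> R[i]).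

Definition is_subspace V :=
  V 0 /\ forall (c : R[i]) u v, V u -> V v -> V (c *: u + v).

Definition lin_indep n (f : 'I_n -> H) :=
  forall c : 'I_n -> R[i], \sum_i c i *: f i = 0 -> forall i, c i = 0.

Definition dimE V : \bar R :=
  ereal_sup [set n%:R%:E | n in
    [set n : nat | exists2 f : 'I_n -> H, forall i, V (f i) & lin_indep f]].

Definition lin_span S : set H :=
  [set u | exists n (c : 'I_n -> R[i]) (f : 'I_n -> H),
     (forall i, S (f i)) /\ u = \sum_i c i *: f i].

Definition orthocompl b S : set H := [set u | forall v, S v -> b u v = 0].

(* p is the b-orthogonal projection of u onto K *)
Definition is_orthoproj b K (u p : H) := K p /\ forall v, K v -> b (u - p) v = 0.

Definition orthoproj_image b K S : set H :=
  [set p | exists2 u, S u & is_orthoproj b K u p].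

End LinearAlgebra.

Section Operators.
Variables (R : realType) (H : normedModType R[i]).
Implicit Types (T : H -> H -> Prop) (z : R[i]).

Definition eigenspace T z : set H := [set u | T u (z *: u)].

Definition eigenvector T (u : H) := u != 0 /\ exists z, T u (z *: u).

Definition resolvent_set T : set R[i] :=
  [set z | (forall f, exists! u, T u (f + z *: u)) /\
           exists M : R[i], forall u f, T u (f + z *: u) -> `|u| <= M * `|f|].

Definition spectrum T : set R[i] := ~` resolvent_set T.

Definition discrete_spectrum T : set R[i] :=
  [set z | [/\ spectrum T z,
    exists2 e : R[i], 0 < e &
      forall w, spectrum T w -> `|w - z| < e -> w = z,
    exists2 u, u != 0 & eigenspace T z u &
    (dimE (eigenspace T z) < +oo)%E]].

Definition ess_spectrum T : set R[i] := spectrum T `\` discrete_spectrum T.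

(* The operators of interest are self-adjoint, so that their spectra are real. *)
Definition ess_bottom T : \bar R :=
  ereal_inf [set x%:E | x in [set x : R | ess_spectrum T x%:C]].

End Operators.

Section SpectralMeasure.
Variables (R : realType) (H : lmodType R[i]).
Variables (V : set H) (b : H -> H -> R[i]) (E : set R -> H -> H).

(* E is a projection-valued measure on the Borel sets of R in the Hilbert
   space V with inner product b. *)
Definition quad_measure (u : H) (L : set R) : \bar R :=
  (complex.Re (b (E L u) u))%:E.

Record projection_valued_measure : Prop := ProjectionValuedMeasure {
  pvm_stable : forall L u, measurable L -> V u -> V (E L u) ;
  pvm_linear : forall L (c : R[i]) u v, measurable L -> V u -> V v ->
    E L (c *: u + v) = c *: E L u + E L v ;
  pvm_selfadjoint : forall L u v, measurable L -> V u -> V v ->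
    b (E L u) v = b u (E L v) ;
  pvm_set0 : forall u, V u -> E set0 u = 0 ;
  pvm_setT : forall u, V u -> E setT u = u ;
  (* in particular each E L is idempotent *)
  pvm_setI : forall L M u, measurable L -> measurable M -> V u ->
    E (L `&` M) u = E L (E M u) ;
  pvm_sigma_additive : forall u, V u -> semi_sigma_additive (quad_measure u) }.

(* E is the spectral measure of the operator T: T = \int t dE(t), that is,
   dom T is the set of u in V such that \int t^2 d(E(t)u,u) < oo, and
   (Tu,u) = \int t d(E(t)u,u) on dom T (by polarization, this determines the
   linear operator T). *)
Record spectral_measure (T : H -> H -> Prop) : Prop := SpectralMeasure {
  sm_pvm : projection_valued_measure ;
  sm_dom : forall u, (exists f, T u f) <->
    V u /\ (\int[quad_measure u]_t (t ^+ 2)%:E < +oo)%E ;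
  sm_eq : forall u f, T u f ->
    V f /\ b f u = (fine (\int[quad_measure u]_t t%:E)%E)%:C }.

End SpectralMeasure.

Section Forms.
Variables (R : realType) (H : normedModType R[i]).
Variable (dot : H -> H -> R[i]).
Implicit Types (V K : set H) (a : H -> H -> R[i]).

Definition form_cvg a (u : nat -> H) (u0 : H) :=
  forall e : R, 0 < e ->
    exists N, forall n, (N <= n)%N -> a (u n - u0) (u n - u0) < e%:C.

Definition form_cauchy a (u : nat -> H) :=
  forall e : R, 0 < e -> exists N, forall m n, (N <= m)%N -> (N <= n)%N ->
    a (u m - u n) (u m - u n) < e%:C.

Record closed_positive_form V a : Prop := ClosedPositiveForm {
  cpf_subspace : is_subspace V ;
  cpf_dense : dense V ;
  cpf_linear : forall (c : R[i]) u v w, V u -> V v -> V w ->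
    a (c *: u + v) w = c * a u w + a v w ;
  cpf_hermitian : forall u v, V u -> V v -> a v u = (a u v)^*%R ;
  cpf_positive : exists2 c : R, 0 < c &
    forall u, V u -> c%:C * dot u u <= a u u ;
  cpf_closed : forall u : nat -> H, (forall n, V (u n)) -> form_cauchy a u ->
    forall u0, u @ \oo --> u0 -> V u0 /\ form_cvg a u u0 }.

(* K is a subspace of V that is closed with respect to the norm a[.]^(1/2) *)
Definition form_closed_subspace V a K :=
  [/\ is_subspace K, K `<=` V &
      forall (u : nat -> H) u0, (forall n, K (u n)) -> V u0 ->
        form_cvg a u u0 -> K u0].

(* The operator in H generated by the form a with domain V. *)
Definition form_op V a (u f : H) :=
  V u /\ forall v, V v -> dot f v = a u v.

End Forms.

Section DirichletNeumann.
Variables (R : realType) (H : normedModType R[i]).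
Variable (dot : H -> H -> R[i]).
Variables (H1 H01 : set H) (a : H -> H -> R[i]).

Definition A_N := form_op dot H1 a.
Definition A_D := form_op dot H01 a.

Definition H1_A : set H :=
  [set u | H1 u /\ {within H01, continuous (fun v => a u v : R[i]^o)}].

Definition A_max (u f : H) := H1_A u /\ forall v, H01 v -> dot f v = a u v.

Definition G (lam : R) : set H := eigenspace A_max lam%:C.

(* B_lam = (I - lam Pi'_lam A_N^-1) restricted to G_lam; here g = A_N^-1 u and
   p = Pi'_lam g. *)
Definition B_op (lam : R) (u w : H) :=
  G lam u /\
  exists g p, [/\ A_N g u, is_orthoproj a (G lam) g p & w = u - lam%:C *: p].

Definition calH0 : set H :=
  lin_span [set u | eigenvector A_N u /\ eigenvector A_D u].

Definition calH : set H := orthocompl dot calH0.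

Definition n_D (lam : R) : \bar R :=
  dimE (orthoproj_image dot (eigenspace A_D lam%:C) calH).

End DirichletNeumann.

(* N(lam) = dim chi_(-oo, lam)(T) H, where E is the spectral measure of T. *)
Definition counting_function (R : realType) (H : lmodType R[i])
    (E : set R -> H -> H) (lam : R) : \bar R :=
  dimE (range (E [set` `]-oo, lam[])).

(* Main.v *)
(** Let q(u, v) = a[u, v] - lam (u, v) on H^1.  By Glazman's lemma each of
    N_N(lam), N_D(lam) and dim G_lam^- is the maximal dimension of a subspace on
    which q is negative, taken in H^1, H_0^1 and G_lam respectively.  The
    q-orthogonal complement of H_0^1 in H^1 is G_lam, and the intersection of
    the two is K = ker(A_D - lam).  Since lam is below the essential spectrum of
    A_D, q is definite, with a gap, on the spectral parts of H_0^1 above and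
    below lam, so the Riesz theorem shows that H_0^1 + G_lam is the
    q-orthogonal complement of K in H^1.  The part K_0 of K orthogonal to all of
    H^1 consists of the common eigenvectors for lam, and K_1, its complement in K, is an
    isotropic space which pairs nondegenerately with H^1 and contributes dim K_1
    = n_D(lam) further negative directions. *)

From HB Require Import structures.
Require Import Defs.
From mathcomp Require Import all_boot all_order all_algebra.
From mathcomp Require Import all_classical all_reals all_analysis.
From mathcomp Require Import measurable_realfun.
From mathcomp Require Import ring lra.
Import Order.TTheory GRing.Theory Num.Theory.
Import numFieldNormedType.Exports.
Local Open Scope classical_set_scope.
Local Open Scope ring_scope.
Set Implicit Arguments.
Unset Strict Implicit.
Unset Printing Implicit Defensive.

(** * Hermitian forms on subspaces *)

(** The spectral measures are known only through their quadratic measures. Commutation of an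
    operator with its spectral projections, vanishing of cross terms and norm bounds on spectral
    windows are all extracted from these scalar measures by additivity and polarization. This is
    done once, for an operator whose form [p] on [W] is bounded below by a multiple of the inner
    product [b] on [V]. Glazman's lemma is then used for three instances: [a] on [H1] and on [H01]
    at level [lam], and [q] on [G] with inner product [a] at level 0, because [B_op] is the operator
    of [q] there. Dimensions may be infinite and no complement is chosen: indices count finite
    families with Gram matrix -1, and upper bounds come from having more vectors than linear
    conditions. The form [- dot] brings the dimension of [K_1] under the same count. Riesz needs a
    complete space, and [H01] is complete for [a], not for [dot]. The spectral gap, which compares
    [a] with [dot], is therefore first turned into an equivalence of [q] or [- q] with [a]. *)

Lemma conj_conjc (R : realType) (z : R[i]) : z^*%R = conjc z.
Proof. by []. Qed.

Lemma Re_conjc (R : realType) (z : R[i]) : complex.Re z^*%R = complex.Re z.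
Proof. by rewrite conj_conjc; case: z. Qed.

Section HermitianForm.
Variables (R : realType) (H : lmodType R[i]).
Implicit Types (V W : set H) (s t : H -> H -> R[i]).
Local Notation Re := (@complex.Re R).

Lemma Re_mulC (r : R) (z : R[i]) : Re (r%:C%C * z) = r * Re z.
Proof. by case: z => x y /=; rewrite mul0r subr0. Qed.

Lemma Re_add (z w : R[i]) : Re (z + w) = Re z + Re w.
Proof. by case: z; case: w. Qed.

Lemma Re_opp (z : R[i]) : Re (- z) = - Re z.
Proof. by case: z. Qed.

Lemma Re_sub (z w : R[i]) : Re (z - w) = Re z - Re w.
Proof. by rewrite Re_add Re_opp. Qed.

Lemma conj_realC (r : R) : (r%:C)%C^*%R = r%:C%C.
Proof. by rewrite conj_conjc /= oppr0. Qed.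

(** The second hypothesis kills the imaginary part. Identities between real parts are lifted to
    complex values in this way, by testing also at ['i%C *: u]. *)
Lemma complex_eq0P (z : R[i]) : Re z = 0 -> Re ('i%C * z) = 0 -> z = 0.
Proof.
by case: z => x y /= -> ; rewrite mul0r mul1r sub0r => /eqP;
  rewrite oppr_eq0 => /eqP ->.
Qed.

Definition hform V s := [/\ is_subspace V,
  forall (c : R[i]) u v w, V u -> V v -> V w ->
    s (c *: u + v) w = c * s u w + s v w &
  forall u v, V u -> V v -> s v u = (s u v)^*%R].

Section Subspace.
Variable V : set H.
Hypothesis sV : is_subspace V.

Lemma subspace0 : V 0. Proof. by case: sV. Qed.

Lemma subspaceP c u v : V u -> V v -> V (c *: u + v).
Proof. by move=> Vu Vv; apply: sV.2. Qed.

Lemma subspaceZ c u : V u -> V (c *: u).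
Proof. by move=> Vu; rewrite -[_ *: _]addr0; apply: subspaceP => //;
  apply: subspace0. Qed.

Lemma subspaceD u v : V u -> V v -> V (u + v).
Proof. by move=> Vu Vv; rewrite -[u]scale1r; apply: subspaceP. Qed.

Lemma subspaceN u : V u -> V (- u).
Proof. by rewrite -scaleN1r; apply: subspaceZ. Qed.

Lemma subspaceB u v : V u -> V v -> V (u - v).
Proof. by move=> Vu Vv; apply: subspaceD => //; apply: subspaceN. Qed.

Lemma subspace_sum n (c : 'I_n -> R[i]) (f : 'I_n -> H) :
  (forall i, V (f i)) -> V (\sum_i c i *: f i).
Proof.
move=> Vf; apply: (big_ind V); [exact: subspace0|exact: subspaceD|].
by move=> i _; apply: subspaceZ.
Qed.

End Subspace.

Section Calculus.
Variables (V : set H) (s : H -> H -> R[i]).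
Hypothesis hs : hform V s.

Lemma hform_subspace : is_subspace V. Proof. by case: hs. Qed.
Let sV := hform_subspace.

Lemma hformC u v : V u -> V v -> s v u = (s u v)^*%R.
Proof. by case: hs => _ _; apply. Qed.

Lemma hformDl u v w : V u -> V v -> V w -> s (u + v) w = s u w + s v w.
Proof.
by case: hs => _ lin _ Vu Vv Vw; rewrite -[u in LHS]scale1r lin// mul1r.
Qed.

Lemma hform0l w : V w -> s 0 w = 0.
Proof.
move=> Vw; have V0 := subspace0 sV.
have := hformDl V0 V0 Vw; rewrite addr0 => /eqP.
by rewrite -subr_eq subrr eq_sym => /eqP.
Qed.

Lemma hformZl c u w : V u -> V w -> s (c *: u) w = c * s u w.
Proof.
move=> Vu Vw; have V0 := subspace0 sV; case: hs => _ lin _.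
by rewrite -[c *: u]addr0 lin// hform0l// addr0.
Qed.

Lemma hformNl u w : V u -> V w -> s (- u) w = - s u w.
Proof. by move=> Vu Vw; rewrite -scaleN1r hformZl// mulN1r. Qed.

Lemma hformBl u v w : V u -> V v -> V w -> s (u - v) w = s u w - s v w.
Proof. by move=> Vu Vv Vw; rewrite hformDl ?hformNl//; apply: subspaceN. Qed.

Lemma hformDr u v w : V u -> V v -> V w -> s w (u + v) = s w u + s w v.
Proof.
move=> Vu Vv Vw; have Vuv := subspaceD sV Vu Vv.
by rewrite (hformC Vuv)// hformDl// rmorphD /= -!hformC.
Qed.

Lemma hformZr c u w : V u -> V w -> s w (c *: u) = c^*%R * s w u.
Proof.
move=> Vu Vw; have Vcu := subspaceZ sV c Vu.
by rewrite (hformC Vcu)// hformZl// rmorphM /= -hformC.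
Qed.

Lemma hform0r w : V w -> s w 0 = 0.
Proof. by move=> Vw; rewrite (hformC _ Vw) ?hform0l ?rmorph0//;
  apply: subspace0. Qed.

Lemma hformNr u w : V u -> V w -> s w (- u) = - s w u.
Proof. by move=> Vu Vw; rewrite -scaleN1r hformZr// rmorphN1 mulN1r. Qed.

Lemma hformBr u v w : V u -> V v -> V w -> s w (u - v) = s w u - s w v.
Proof. by move=> Vu Vv Vw; rewrite hformDr ?hformNr//; apply: subspaceN. Qed.

Lemma hform_suml n (c : 'I_n -> R[i]) (f : 'I_n -> H) w :
  (forall i, V (f i)) -> V w ->
  s (\sum_i c i *: f i) w = \sum_i c i * s (f i) w.
Proof.
move=> Vf Vw.
pose P (u : H) z := V u /\ s u w = z.
suff [] : P (\sum_i c i *: f i) (\sum_i c i * s (f i) w) by [].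
apply: (big_rec2 P); first by split; [exact: subspace0|exact: hform0l].
move=> i z u _ [Vu <-]; have Vcf := subspaceZ sV (c i) (Vf i).
by split; [exact: subspaceD|rewrite hformDl// hformZl].
Qed.

Lemma hform_real u : V u -> s u u = (Re (s u u))%:C%C.
Proof.
move=> Vu; have := hformC Vu Vu; rewrite conj_conjc;
  case: (s u u) => x y /= [] /eqP.
by rewrite -addr_eq0 -mulr2n mulrn_eq0 /= => /eqP ->.
Qed.

Lemma ReC u v : V u -> V v -> Re (s u v) = Re (s v u).
Proof. by move=> Vu Vv; rewrite (hformC Vu Vv) Re_conjc. Qed.

Lemma Re_sqrD u v : V u -> V v ->
  Re (s (u + v) (u + v)) = Re (s u u) + 2 * Re (s u v) + Re (s v v).
Proof.
move=> Vu Vv; have Vuv := subspaceD sV Vu Vv.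
by rewrite hformDl// !hformDr// !Re_add (ReC Vv Vu); ring.
Qed.

Lemma Re_sqrB u v : V u -> V v ->
  Re (s (u - v) (u - v)) = Re (s u u) - 2 * Re (s u v) + Re (s v v).
Proof.
move=> Vu Vv; have Vnv := subspaceN sV Vv.
by rewrite Re_sqrD// !hformNr// hformNl// !Re_opp; ring.
Qed.

Lemma ReZl (r : R) u v : V u -> V v -> Re (s (r%:C%C *: u) v) = r * Re (s u v).
Proof. by move=> Vu Vv; rewrite hformZl// Re_mulC. Qed.

Lemma ReZr (r : R) u v : V u -> V v -> Re (s u (r%:C%C *: v)) = r * Re (s u v).
Proof. by move=> Vu Vv; rewrite hformZr// conj_realC Re_mulC. Qed.

Lemma Re_sqrZ (r : R) u : V u ->
  Re (s (r%:C%C *: u) (r%:C%C *: u)) = r ^+ 2 * Re (s u u).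
Proof. by move=> Vu; rewrite ReZl ?ReZr//; [ring|apply: subspaceZ]. Qed.

Lemma Re_sqrZ_norm c u : V u ->
  s (c *: u) (c *: u) = `|c| ^+ 2 * s u u.
Proof.
move=> Vu; have Vcu := subspaceZ sV c Vu.
by rewrite hformZl// hformZr// mulrA normCK.
Qed.

Lemma hform_eq0_Re u v : V u -> V v ->
  Re (s u v) = 0 -> Re (s ('i%C *: u) v) = 0 -> s u v = 0.
Proof.
by move=> Vu Vv h1; rewrite hformZl// => h2; exact: complex_eq0P.
Qed.

(** Positivity at [x *: u - v], divided by [x]. It stands in for the Cauchy-Schwarz inequality, with
    the weight [x] chosen at each use and no square roots. *)
Lemma Re_amgm (x : R) u v : (forall w, V w -> 0 <= Re (s w w)) -> 0 < x ->
  V u -> V v -> 2 * Re (s u v) <= x * Re (s u u) + x^-1 * Re (s v v).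
Proof.
move=> pos x0 Vu Vv; have Vxu := subspaceZ sV x%:C%C Vu.
have := pos _ (subspaceB sV Vxu Vv).
rewrite Re_sqrB// Re_sqrZ// ReZl// => h.
rewrite -(@ler_pM2l _ x)// mulrDr !mulrA divff ?gt_eqF// mul1r.
by rewrite mulrAC (mulrC _ 2) -mulrA -subr_ge0 in h *; nra.
Qed.

End Calculus.

Lemma hform_sub V W s : hform V s -> is_subspace W -> W `<=` V -> hform W s.
Proof.
case=> _ lin herm sW WV; split => //.
- by move=> c u v w Wu Wv Ww; apply: lin; apply: WV.
- by move=> u v Wu Wv; apply: herm; apply: WV.
Qed.

Lemma hformB V s t (r : R) : hform V s -> hform V t ->
  hform V (fun u v => s u v - r%:C%C * t u v).
Proof.
move=> [sV ls hs] [_ lt ht]; split => //.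
- by move=> c u v w Vu Vv Vw; rewrite ls// lt//; ring.
- by move=> u v Vu Vv; rewrite hs// ht// rmorphB rmorphM /= conj_realC.
Qed.

Lemma hformN V s : hform V s -> hform V (fun u v => - s u v).
Proof.
move=> [sV ls hs]; split => //.
- by move=> c u v w Vu Vv Vw; rewrite ls//; ring.
- by move=> u v Vu Vv; rewrite hs// rmorphN.
Qed.

End HermitianForm.

(** * Index of a form relative to a subspace *)

Section NegativeFamilies.
Variables (R : realType) (H : lmodType R[i]).
Implicit Types (V W : set H) (s t : H -> H -> R[i]) (e : nat -> H).
Local Notation Re := (@complex.Re R).

(* Gram matrix [-1]; only the values of [e] below [n] matter. *)
Definition neg_family V s n e :=
  (forall i, (i < n)%N -> V (e i)) /\
  forall i j, (i < n)%N -> (j < n)%N -> s (e i) (e j) = - (i == j)%:R.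

Definition neg_sizes V s : set nat := [set n | exists e, neg_family V s n e].

Definition sup_size (P : set nat) : \bar R := ereal_sup [set n%:R%:E | n in P].

Lemma neg_sizes0 V s : neg_sizes V s 0%N.
Proof. by exists (fun=> 0); split. Qed.

Lemma neg_sizes_le V s m n : (m <= n)%N -> neg_sizes V s n -> neg_sizes V s m.
Proof.
move=> mn [e [Ve ge]]; exists e; split => [i im|i j im jm].
- by apply: Ve; apply: leq_trans mn.
- by apply: ge; [apply: leq_trans im mn|apply: leq_trans jm mn].
Qed.

Lemma sup_size_cases (P : set nat) : P 0%N ->
  (forall m n, (m <= n)%N -> P n -> P m) ->
  (exists n, [/\ P n, ~ P n.+1 & sup_size P = n%:R%:E]) \/
  ((forall n, P n) /\ sup_size P = +oo%E).
Proof.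
move=> P0 Ple; have [Pall|/existsNP[N PN]] := pselect (forall n, P n).
  right; split=> //; apply/eqyP => A A0.
  apply: le_trans (_ : (Num.trunc A).+1%:R%:E <= _)%E.
    by rewrite lee_fin ltW// truncnS_gt.
  by apply: ereal_sup_ubound; exists (Num.trunc A).+1.
left; elim: N PN => // N IH PN.
have [PN'|/IH//] := pselect (P N).
exists N; split => //; apply/eqP; rewrite eq_le; apply/andP; split.
- apply: ge_ereal_sup => _ [n Pn <-]; rewrite lee_fin ler_nat leqNgt.
  by apply/negP => Nn; apply: PN; apply: Ple Pn.
- by apply: ereal_sup_ubound; exists N.
Qed.

Lemma neg_sizes_cases V s :
  (exists n, [/\ neg_sizes V s n, ~ neg_sizes V s n.+1 &
     sup_size (neg_sizes V s) = n%:R%:E]) \/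
  ((forall n, neg_sizes V s n) /\ sup_size (neg_sizes V s) = +oo%E).
Proof.
by apply: sup_size_cases; [exact: neg_sizes0|exact: neg_sizes_le].
Qed.

(** The coefficient matrix has rank at most [m < N], so its left kernel is nonzero. The dimension
    counts below use this to find a combination orthogonal to fewer vectors than it has terms. *)
Lemma linear_conditions N m (F : 'I_N -> 'I_m -> R[i]) : (m < N)%N ->
  exists2 c : 'I_N -> R[i], (exists i, c i != 0) &
    forall j, \sum_i c i * F i j = 0.
Proof.
move=> mN; pose M : 'M[R[i]]_(N, m) := \matrix_(i, j) F i j.
have /rowV0Pn[v /sub_kermxP vM v0] : kermx M != 0.
  rewrite -mxrank_eq0 mxrank_ker subn_eq0 -ltnNge.
  exact: leq_ltn_trans (rank_leq_col M) mN.
exists (v 0); first by case/rV0Pn: v0 => i vi; exists i.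
move=> j; have /matrixP/(_ 0 j) := vM; rewrite !mxE => vMj.
by rewrite -[RHS]vMj; apply: eq_bigr => i _; rewrite mxE.
Qed.

Section Form.
Variables (V : set H) (s : H -> H -> R[i]).
Hypothesis hs : hform V s.
Let sV := hform_subspace hs.

Lemma neg_family_coef n e (c : 'I_n -> R[i]) (j : 'I_n) : neg_family V s n e ->
  s (\sum_(i < n) c i *: e i) (e j) = - c j.
Proof.
move=> [Ve ge]; rewrite (hform_suml hs) => [||]; last 2 first.
- by move=> i; apply: Ve.
- exact: Ve.
rewrite (bigD1 j)//= ge// eqxx mulrN mulr1 big1 ?addr0// => i ij.
by rewrite ge// val_eqE (negbTE ij) oppr0 mulr0.
Qed.

Lemma neg_family_sqr n e (c : 'I_n -> R[i]) : neg_family V s n e ->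
  s (\sum_(i < n) c i *: e i) (\sum_(i < n) c i *: e i)
    = - \sum_(i < n) `|c i| ^+ 2.
Proof.
move=> ne; have [Ve ge] := ne.
have Vc : V (\sum_(i < n) c i *: e i).
  by apply: subspace_sum => // i; apply: Ve.
rewrite [LHS](hform_suml hs)//; last by move=> i; apply: Ve.
rewrite -sumrN; apply: eq_bigr => i _.
rewrite (hformC hs)//; last exact: Ve.
by rewrite neg_family_coef// rmorphN mulrN normCK.
Qed.

Lemma sqr_sum_gt0 n (c : 'I_n -> R[i]) : (exists i, c i != 0) ->
  0 < Re (\sum_(i < n) `|c i| ^+ 2).
Proof.
case=> i ci; suff : 0 < \sum_(i < n) `|c i| ^+ 2 by rewrite ltcE => /andP[].
rewrite (bigD1 i)//=; apply: ltr_wpDr; last by rewrite exprn_gt0// normr_gt0.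
by apply: sumr_ge0 => j _; rewrite exprn_ge0.
Qed.

Lemma neg_family_sqr_lt0 n e (c : 'I_n -> R[i]) : neg_family V s n e ->
  (exists i, c i != 0) ->
  Re (s (\sum_(i < n) c i *: e i) (\sum_(i < n) c i *: e i)) < 0.
Proof.
by move=> ne c0; rewrite neg_family_sqr// Re_opp oppr_lt0; apply: sqr_sum_gt0.
Qed.

Lemma neg_family_extend n e x : neg_family V s n e -> V x ->
  Re (s x x) < 0 -> (forall i, (i < n)%N -> s x (e i) = 0) ->
  exists2 e', neg_family V s n.+1 e' & forall i, (i < n)%N -> e' i = e i.
Proof.
move=> [Ve ge] Vx sx sxe; pose r := (Num.sqrt (- Re (s x x)))^-1.
have r2 : r ^+ 2 * Re (s x x) = -1.
  rewrite exprVn sqr_sqrtr ?oppr_ge0 ?ltW// invrN mulNr mulVf//.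
  by rewrite lt_eqF.
set y := r%:C%C *: x; have Vy : V y := subspaceZ sV r%:C%C Vx.
have syy : s y y = -1.
  by rewrite (hform_real hs)// (Re_sqrZ hs)// r2 rmorphN1.
have sye k : (k < n)%N -> s y (e k) = 0.
  by move=> kn; rewrite (hformZl hs) ?sxe ?mulr0//; apply: Ve.
have sey k : (k < n)%N -> s (e k) y = 0.
  by move=> kn; rewrite (hformC hs Vy) ?sye ?rmorph0//; apply: Ve.
exists (fun i => if (i < n)%N then e i else y); last by move=> i ->.
split.
  by move=> i _; case: ifP => // /Ve.
move=> i j; rewrite !ltnS => ni nj.
case: ltnP => ni'; case: ltnP => nj'.
- exact: ge.
- by rewrite sey// ltn_eqF ?oppr0//; apply: leq_trans nj'.
- by rewrite sye// gtn_eqF ?oppr0//; apply: leq_trans ni'.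
- have -> : i = n by apply/eqP; rewrite eqn_leq ni ni'.
  by have -> : j = n; [apply/eqP; rewrite eqn_leq nj nj'|rewrite eqxx].
Qed.

(** The Gram matrix is -1, so removing the components of [x] along the family means adding the terms
    [s x (e i) *: e i]. *)
Lemma neg_family_project n e x : neg_family V s n e -> V x ->
  V (x + \sum_(i < n) s x (e i) *: e i) /\
  forall j, (j < n)%N -> s (x + \sum_(i < n) s x (e i) *: e i) (e j) = 0.
Proof.
move=> ne Vx; have Vs : V (\sum_(i < n) s x (e i) *: e i).
  by apply: subspace_sum => // i; apply: ne.1.
split=> [|j jn]; first exact: subspaceD.
rewrite (hformDl hs)//; last exact: ne.1.
rewrite (neg_family_coef (fun i => s x (e i)) (Ordinal jn) ne).
exact: subrr.
Qed.

(** Each new vector comes from the span of all of [f]: [m < n] conditions leave a nonzero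
    combination orthogonal to the [m] vectors found so far, and it is negative by hypothesis.
    Nothing about the span of the new family has to be tracked. *)
Lemma gram_schmidt n (f : 'I_n -> H) :
  (forall c : 'I_n -> R[i], (exists i, c i != 0) ->
     Re (s (\sum_i c i *: f i) (\sum_i c i *: f i)) < 0) ->
  (forall i, V (f i)) -> neg_sizes V s n.
Proof.
move=> neg Vf; suff main m : (m <= n)%N -> neg_sizes V s m by exact: main.
elim: m => [_|m IH mn]; first exact: neg_sizes0.
have [e ne] := IH (ltnW mn).
have [c c0 cs] := linear_conditions (fun i (j : 'I_m) => s (f i) (e j)) mn.
have [|||e' ne' _] := neg_family_extend ne (x := \sum_i c i *: f i);
  last by exists e'.
- exact: subspace_sum.
- exact: neg.
- move=> j jm; rewrite (hform_suml hs)//; last exact: ne.1.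
  exact: (cs (Ordinal jm)).
Qed.

Lemma neg_family_max n e x : neg_family V s n e -> ~ neg_sizes V s n.+1 ->
  V x -> (forall i, (i < n)%N -> s x (e i) = 0) -> 0 <= Re (s x x).
Proof.
move=> ne max Vx xe; rewrite leNgt; apply/negP => sx; apply: max.
by have [e' ne' _] := neg_family_extend ne Vx sx xe; exists e'.
Qed.

End Form.

Lemma lin_indep_neq0 n (f : 'I_n -> H) (c : 'I_n -> R[i]) :
  lin_indep f -> (exists i, c i != 0) -> \sum_i c i *: f i != 0.
Proof.
by move=> lf [i ci]; apply: contraNneq ci => /lf ->.
Qed.

(** Both sides count the same sizes: [gram_schmidt] normalizes an independent family, and a family
    with Gram matrix -1 is independent since its coefficients can be read off. *)
Lemma dimE_neg_sizes V s : hform V s ->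
  (forall x, V x -> x != 0 -> Re (s x x) < 0) ->
  dimE V = sup_size (neg_sizes V s).
Proof.
move=> hs neg; have sV := hform_subspace hs.
rewrite /dimE /sup_size; congr ereal_sup; congr image.
apply/seteqP; split=> n.
- move=> [f Vf lf]; apply: (gram_schmidt hs (f := f)) => // c c0.
  by apply: neg; [exact: subspace_sum|exact: lin_indep_neq0].
- move=> [e ne]; exists (fun i : 'I_n => e i) => [i|c ce i].
    exact: ne.1.
  have := neg_family_coef hs c i ne.
  rewrite ce (hform0l hs); last exact: ne.1.
  by move=> /esym/eqP; rewrite oppr_eq0 => /eqP.
Qed.

Lemma neg_sizes_sub V W s n : W `<=` V -> neg_sizes W s n -> neg_sizes V s n.
Proof. by move=> WV [e [We ge]]; exists e; split=> // i /We /WV. Qed.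

Definition cat_family n (e f : nat -> H) i :=
  if (i < n)%N then e i else f (i - n)%N.

Lemma neg_family_cat V s n m e f : hform V s ->
  neg_family V s n e -> neg_family V s m f ->
  (forall i j, (i < n)%N -> (j < m)%N -> s (e i) (f j) = 0) ->
  neg_family V s (n + m) (cat_family n e f).
Proof.
move=> hs [Ve ge] [Vf gf] ef; rewrite /cat_family.
have lt i : (i < n + m)%N -> (n <= i)%N -> (i - n < m)%N.
  by move=> inm ni; rewrite ltn_subLR.
split=> [i inm|i j inm jnm].
  by case: ltnP => ni; [exact: Ve|apply: Vf; exact: lt].
case: ltnP => ni; case: ltnP => nj.
- exact: ge.
- by rewrite ef ?ltn_eqF ?oppr0 ?lt//; apply: leq_trans nj.
- rewrite (hformC hs) ?ef ?rmorph0 ?gtn_eqF ?oppr0 ?lt//; last 2 first.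
  + exact: Ve.
  + by apply: Vf; exact: lt.
  + exact: leq_trans ni.
- by rewrite gf ?lt// eqn_sub2rE//.
Qed.

(** * The index as a sum over a subspace, an isotropic part and the orthogonal complement *)

Section Index.
Variables (V D K1 : set H) (q t : H -> H -> R[i]).
Hypotheses (hq : hform V q) (ht : hform V t).
(** The auxiliary form [t] only serves to count the dimension of [K1] by families, as is done for
    [q]. *)
Hypothesis tneg : forall x, V x -> x != 0 -> Re (t x x) < 0.
Hypotheses (sD : is_subspace D) (DV : D `<=` V) (sK1 : is_subspace K1).
Let G : set H := [set u | V u /\ forall v, D v -> q u v = 0].
Hypothesis K1D : K1 `<=` D.
Hypothesis K1G : K1 `<=` G.
Hypothesis K1_dual : forall k, K1 k -> k != 0 -> exists2 u, V u & q u k != 0.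
(** The analytic input: it writes a vector orthogonal to [K1] as the sum of [w] in [D] and [x - w]
    in [G]. *)
Hypothesis solve : forall x, V x -> (forall k, K1 k -> q x k = 0) ->
  exists2 w, D w & forall v, D v -> q w v = q x v.
Let sV := hform_subspace hq.

(* An isotropic vector [h] with [q u h = 1] yields a new negative direction
   [u - r h], [r = (q u u + 1) / 2], once [u] is orthogonal to the family. *)
Lemma index_ge n r p : neg_sizes D q n -> neg_sizes K1 t r ->
  neg_sizes G q p -> neg_sizes V q (n + r + p)%N.
Proof.
move=> [e ne] [k nk] [g ng].
have GV : G `<=` V by move=> u [].
have hK1 : hform K1 t by apply: hform_sub ht _ _ => // u /K1D /DV.
have neV : neg_family V q n e by split; [move=> i /ne.1 /DV|exact: ne.2].
have ngV : neg_family V q p g by split; [move=> i /ng.1 /GV|exact: ng.2].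
have ne0 : neg_family V q (n + p) (cat_family n e g).
  apply: neg_family_cat => // i j ip jn.
  rewrite (hformC hq (ngV.1 _ jn) (neV.1 _ ip)).
  by have [_ ->] := ng.1 _ jn; rewrite ?rmorph0//; apply: ne.1.
set e0 := cat_family n e g in ne0.
have e0K i h : K1 h -> (i < n + p)%N -> q h (e0 i) = 0.
  move=> Kh inp; have [Vh Gh] := K1G Kh.
  rewrite /e0 /cat_family; case: ltnP => ni; first by apply: Gh; apply: ne.1.
  have pin : (i - n < p)%N by rewrite ltn_subLR.
  rewrite (hformC hq (ngV.1 _ pin) Vh).
  by have [_ ->] := ng.1 _ pin; rewrite ?rmorph0//; apply: K1D.
suff main m : (m <= r)%N -> exists2 x, neg_family V q (n + p + m) x &
    forall i, (i < n + p)%N -> x i = e0 i.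
  by have [x nx _] := main r (leqnn r); exists x; rewrite addnAC.
elim: m => [_|m IH mr]; first by exists e0; rewrite ?addn0.
have [x nx xe0] := IH (ltnW mr).
(* There are [r] vectors [k j] and only [m < r] earlier additions, so some nonzero [h] in [K1] is
   orthogonal to these. Orthogonality to [e0] is automatic because [K1] lies in both [D] and [G]. *)
have [c c0 cs] :=
  linear_conditions (fun (j : 'I_r) (i : 'I_m) => q (k j) (x (n + p + i)%N)) mr.
pose h := \sum_(j < r) c j *: k j.
have Kh : K1 h by apply: subspace_sum => // j; apply: nk.1.
have Vh : V h by apply: DV; apply: K1D.
have h0 : h != 0.
  apply: contraTneq (neg_family_sqr_lt0 hK1 nk c0) => h0.
  by rewrite -/h h0 (hform0l hK1) ?ltxx//; apply: subspace0.
have hx i : (i < n + p + m)%N -> q h (x i) = 0.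
  move=> im; case: (ltnP i (n + p)) => inp; first by rewrite xe0// e0K.
  have im' : (i - (n + p) < m)%N by rewrite ltn_subLR.
  rewrite (hform_suml hq); last 2 first.
  - by move=> j; apply: DV; apply: K1D; apply: nk.1.
  - exact: nx.1.
  by have := cs (Ordinal im'); rewrite /= subnKC.
have qhh : q h h = 0 by apply: (K1G Kh).2; apply: K1D.
have [u Vu quh] := K1_dual Kh h0.
pose u1 := (q u h)^-1 *: u.
have Vu1 : V u1 by apply: subspaceZ.
have qu1h : q u1 h = 1 by rewrite (hformZl hq)// mulVf.
(* Projecting [u1] off the family does not change its pairing with [h], which is orthogonal to the
   family. *)
have [] := neg_family_project hq nx Vu1.
set u2 := u1 + _ => Vu2 u2x.
have qu2h : q u2 h = 1.
  rewrite (hformC hq Vh Vu2) (hformDr hq)//; last first.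
    by apply: subspace_sum => // i; apply: nx.1.
  rewrite (hformC hq Vu1 Vh) qu1h rmorph1.
  rewrite (hformC hq) //; last by apply: subspace_sum => // i; apply: nx.1.
  rewrite (hform_suml hq)//; last by move=> i; apply: nx.1.
  rewrite big1 ?rmorph0 ?addr0 ?rmorph1// => i _.
  by rewrite (hformC hq Vh) ?hx ?rmorph0 ?mulr0//; apply: nx.1.
pose r1 : R := (Re (q u2 u2) + 1) / 2.
have Vr1h : V (r1%:C%C *: h) by apply: subspaceZ.
have [||i im|x' nx' xx'] := neg_family_extend hq nx (x := u2 - r1%:C%C *: h).
- exact: subspaceB.
- rewrite (Re_sqrB hq)// (Re_sqrZ hq)// (ReZr hq)// qu2h qhh /= /r1.
  by rewrite mulr1 mulr0 addr0 mulrC divfK// opprD addrA subrr sub0r oppr_lt0.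
- rewrite (hformBl hq)//; last exact: nx.1.
  by rewrite u2x// (hformZl hq) ?hx ?mulr0 ?subrr//; apply: nx.1.
- exists x'; first by rewrite addnS.
  move=> i inp; rewrite xx' ?xe0//; exact: leq_trans inp (leq_addr _ _).
Qed.

(* A negative space of too large dimension contains a nonzero [X] which is
   [q]-orthogonal to maximal families of [D], [K1] and [G].  Then [X = w + z]
   with [w] in [D], [z] in [G], and [q] is nonnegative at both. *)
Lemma index_le n r p : neg_sizes D q n -> ~ neg_sizes D q n.+1 ->
  neg_sizes K1 t r -> ~ neg_sizes K1 t r.+1 ->
  neg_sizes G q p -> ~ neg_sizes G q p.+1 ->
  ~ neg_sizes V q (n + r + p).+1%N.
Proof.
move=> [e ne] maxe [k nk] maxk [g ng] maxg [x nx].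
have sG : is_subspace G.
  split=> [|c u v [Vu Gu] [Vv Gv]].
    split=> [|v /DV]; [exact: subspace0|exact: (hform0l hq)].
  split=> [|w Dw]; first exact: subspaceP.
  by case: hq => _ -> //; [rewrite Gu// Gv// mulr0 addr0|exact: DV].
have GV : G `<=` V by move=> u [].
have hD : hform D q by apply: hform_sub hq _ _.
have hG : hform G q by apply: hform_sub hq _ _.
have hK1 : hform K1 t by apply: hform_sub ht _ _ => // u /K1D /DV.
pose F (i : 'I_(n + r + p).+1) (j : 'I_(n + r + p)) :=
  q (x i) (cat_family (n + r) (cat_family n e k) g j).
have [c c0 cs] := linear_conditions F (ltnSn _).
set X := \sum_(i < (n + r + p).+1) c i *: x i.
have VX : V X by apply: subspace_sum => // i; apply: nx.1.
have Vcat j : (j < n + r + p)%N -> V (cat_family (n + r) (cat_family n e k) g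
  j).
  move=> jN; rewrite /cat_family; case: ltnP => jnr; last first.
    by apply: GV; apply: ng.1; rewrite ltn_subLR.
  case: ltnP => jn; first by apply: DV; apply: ne.1.
  by apply: DV; apply: K1D; apply: nk.1; rewrite ltn_subLR.
have qX j : (j < n + r + p)%N -> q X (cat_family (n + r) (cat_family n e k) g
  j) = 0.
  move=> jN; rewrite (hform_suml hq); last 2 first.
  - by move=> i; apply: nx.1.
  - exact: Vcat.
  exact: (cs (Ordinal jN)).
have qXe i : (i < n)%N -> q X (e i) = 0.
  move=> ilt; have := qX i; rewrite /cat_family (ltn_addr r ilt) ilt; apply.
  exact: ltn_addr (ltn_addr _ ilt).
have qXk i : (i < r)%N -> q X (k i) = 0.
  move=> ilt; have := qX (n + i)%N.
  rewrite /cat_family ltn_add2l ilt.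
  rewrite [X in if X then _ else _]ltnNge leq_addr addKn; apply.
  by apply: ltn_addr; rewrite ltn_add2l.
have qXg i : (i < p)%N -> q X (g i) = 0.
  move=> ilt; have := qX (n + r + i)%N.
  rewrite /cat_family [X in if X then _ else _]ltnNge leq_addr addKn; apply.
  by rewrite ltn_add2l.
(* By maximality of [k] and definiteness of [t], the projection of [h] off [k] vanishes. Hence [k]
   spans [K1]. *)
have qXK h : K1 h -> q X h = 0.
  move=> Kh; have [] := neg_family_project hK1 nk Kh.
  set h1 := h + _ => Kh1 h1k.
  have Ks : K1 (\sum_(i < r) t h (k i) *: k i).
    by apply: subspace_sum => // i; apply: nk.1.
  have h10 : h1 = 0.
    have [//|/(tneg (DV (K1D Kh1)))] := eqVneq h1 0.
    by rewrite ltNge (neg_family_max hK1 nk maxk).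
  have -> : h = - \sum_(i < r) t h (k i) *: k i.
    by apply/eqP; rewrite -addr_eq0; apply/eqP.
  have Vk i : (i < r)%N -> V (k i) by move=> ?; apply: DV; apply: K1D;
    apply: nk.1.
  have Vs := DV (K1D Ks).
  rewrite (hformNr hq)// (hformC hq Vs VX) (hform_suml hq)//; last first.
    by move=> i; apply: Vk.
  rewrite big1 ?rmorph0 ?oppr0// => i _.
  by rewrite (hformC hq VX) ?qXk ?rmorph0 ?mulr0//; apply: Vk.
have [w Dw qw] := solve VX qXK.
have Vw := DV Dw.
have Gz : G (X - w).
  split=> [|v Dv]; first exact: subspaceB.
  by rewrite (hformBl hq) ?qw ?subrr//; apply: DV.
have w_ge0 : 0 <= Re (q w w).
  apply: (neg_family_max hD ne maxe) => // i ilt.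
  by rewrite qw ?qXe//; apply: ne.1.
have z_ge0 : 0 <= Re (q (X - w) (X - w)).
  apply: (neg_family_max hG ng maxg) => // i ilt.
  have [Vgi Ggi] := ng.1 _ ilt.
  by rewrite (hformBl hq)// qXg// (hformC hq Vgi Vw) Ggi// rmorph0 subrr.
have := neg_family_sqr_lt0 hq nx c0; rewrite -/X ltNge => /negP; apply.
have -> : X = w + (X - w) by rewrite addrC subrK.
rewrite (Re_sqrD hq)//; last exact: GV.
rewrite (hformC hq (GV _ Gz) Vw) Gz.2// rmorph0 mulr0 addr0.
exact: addr_ge0.
Qed.

(** Families of [D] or [G] are families of [V], which settles the infinite cases. Otherwise all
    three maximal families exist and the two bounds meet. *)
Lemma index_theorem : (dimE K1 < +oo)%E ->
  sup_size (neg_sizes V q) =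
  (sup_size (neg_sizes D q) + dimE K1 + sup_size (neg_sizes G q))%E.
Proof.
have hK1 : hform K1 t by apply: hform_sub ht _ _ => // u /K1D /DV.
rewrite (dimE_neg_sizes hK1); last by move=> x /K1D /DV; apply: tneg.
have GV : G `<=` V by move=> u [].
have Voo : (forall n, neg_sizes V q n) -> sup_size (neg_sizes V q) = +oo%E.
  by move=> Vall; case: (neg_sizes_cases V q) => [[n [_ /(_ (Vall _))]]|[]].
case: (neg_sizes_cases K1 t) => [[r [Kr Kr' ->]]|[_ ->]]; last by rewrite ltxx.
move=> _; case: (neg_sizes_cases D q) => [[n [Dn Dn' ->]]|[Dall ->]];
  last first.
  rewrite addye.
    by apply: Voo => m; exact: neg_sizes_sub (Dall m).
  by case: (neg_sizes_cases G q) => [[p [_ _ ->]]|[_ ->]].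
case: (neg_sizes_cases G q) => [[p [Gp Gp' ->]]|[Gall ->]]; last first.
  by rewrite addey//; apply: Voo => m; exact: neg_sizes_sub (Gall m).
have Vm := index_ge Dn Kr Gp; have Vm' := index_le Dn Dn' Kr Kr' Gp Gp'.
case: (neg_sizes_cases V q) => [[m [Vmm Vmm' ->]]|[Vall _]]; last first.
  by case: Vm'.
rewrite -!EFinD -!natrD; congr (_%:R%:E).
apply/eqP; rewrite eqn_leq; apply/andP; split.
- by rewrite leqNgt; apply/negP => lt; apply: Vm'; apply: neg_sizes_le Vmm.
- by rewrite leqNgt; apply/negP => lt; apply: Vmm'; apply: neg_sizes_le Vm.
Qed.

End Index.
End NegativeFamilies.

(** * Spectral measures *)

Section MeanBounds.
Variables (R : realType) (m : {measure set R -> \bar R}) (r : R).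
Hypothesis mT : m setT = r%:E.

Lemma integrable_finite_cst (k : R) : m.-integrable setT (EFin \o cst k).
Proof.
apply/integrableP; split; first exact/measurable_EFinP.
rewrite [X in (X < _)%E](_ : _ = (`|k| * r)%:E) ?ltry//.
by rewrite -[LHS]/(\int[m]_t (cst `|k|%:E) t)%E integral_cst// mT.
Qed.

Lemma integral_finite_cst (k : R) :
  (\int[m]_t (EFin \o cst k) t = (k * r)%:E)%E.
Proof. by rewrite -[LHS]/(\int[m]_t (cst k%:E) t)%E integral_cst// mT. Qed.

Variables (L : set R) (x y : R).
Hypotheses (xy : x <= y) (mL : measurable L) (mL0 : m (~` L) = 0%E).
Hypothesis Lxy : forall t, L t -> x <= t <= y.

(** The identity on [L] and the constant [x] elsewhere: a bounded function that equals [t] almost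
    everywhere, so that integrability comes for free. *)
Let clamp (t : R) : R := x + (t - x) * \1_L t.

Let measurable_clamp : measurable_fun setT clamp.
Proof.
apply: measurable_funD; first exact: measurable_cst.
apply: measurable_funM; last exact: measurable_indic.
by apply: measurable_funB; [exact: measurable_id|exact: measurable_cst].
Qed.

Let clampE t : L t -> clamp t = t.
Proof. by move=> Lt; rewrite /clamp indicE mem_set// mulr1 addrC subrK. Qed.

Let clamp_bounds t : x <= clamp t <= y.
Proof.
have [Lt|Lt] := pselect (L t); first by rewrite clampE//; exact: Lxy.
by rewrite /clamp indicE memNset// mulr0 addr0 lexx.
Qed.

Let ae_clamp (f : R -> R) : ae_eq m setT (EFin \o f) (EFin \o (f \o clamp)).
Proof.
exists (~` L); split; [exact: measurableC|exact: mL0|].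
by move=> t /= nt Lt; apply: nt => _; rewrite /= clampE.
Qed.

Let clamp_norm t : `|clamp t| <= `|x| + `|y|.
Proof.
have /andP[h1 h2] := clamp_bounds t.
have := ler_norm y; have := ler_norm (- x); rewrite normrN => nx ny.
have := normr_ge0 x; have := normr_ge0 y.
by rewrite ler_norml => ? ?; apply/andP; split; lra.
Qed.

Let integrable_clamp : m.-integrable setT (EFin \o clamp).
Proof.
apply: (le_integrable _ _ _ (integrable_finite_cst (`|x| + `|y|))) => //.
  exact/measurable_EFinP.
by move=> t _ /=; rewrite lee_fin [leRHS]ger0_norm ?addr_ge0.
Qed.

Lemma second_moment_finite : (\int[m]_t (t ^+ 2)%:E < +oo)%E.
Proof.
rewrite (ae_eq_integral _ _ _ _ _ (ae_clamp (fun t => t ^+ 2)))//; last 2 first.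
- by apply/measurable_EFinP; exact: measurable_funX.
- by apply/measurable_EFinP; apply: measurable_funX.
pose k : R := (`|x| + `|y|) ^+ 2.
apply: (@le_lt_trans _ _ (\int[m]_t (EFin \o cst k) t)%E).
  apply: ge0_le_integral => //.
  - by move=> t _; rewrite lee_fin sqr_ge0.
  - by apply/measurable_EFinP; apply: measurable_funX.
  - by apply/measurable_EFinP.
  move=> t _; rewrite /= lee_fin -[leLHS]ger0_norm ?sqr_ge0// normrX.
  by rewrite lerXn2r// nnegrE// addr_ge0.
by rewrite integral_finite_cst ltry.
Qed.

Let integral_clamp : (\int[m]_t t%:E = \int[m]_t (EFin \o clamp) t)%E.
Proof.
apply: (ae_eq_integral _ _ _ _ _ (ae_clamp id)) => //.
all: by apply/measurable_EFinP.
Qed.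

Lemma mean_bounds :
  x * r <= fine (\int[m]_t t%:E)%E <= y * r.
Proof.
rewrite integral_clamp; have intc := integrable_clamp.
have fin := integrable_fin_num measurableT intc.
rewrite -!lee_fin fineK// -!integral_finite_cst; apply/andP; split.
- apply: le_integral => //; first exact: integrable_finite_cst.
  by move=> t _; rewrite lee_fin; case/andP: (clamp_bounds t).
- apply: le_integral => //; first exact: integrable_finite_cst.
  by move=> t _; rewrite lee_fin; case/andP: (clamp_bounds t).
Qed.

(** In case of equality the nonnegative function [y - clamp] has integral zero, so [clamp] equals
    [y] almost everywhere. As [clamp t = t < y] on [L], the set [L] would be null, against the
    positive total mass. *)
Lemma mean_lt_sup : (forall t, L t -> t < y) -> 0 < r ->
  fine (\int[m]_t t%:E)%E < y * r.
Proof.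
move=> Ly r0; have /andP[_] := mean_bounds; rewrite le_eqVlt => /predU1P[eq|//].
have intc := integrable_clamp; have inty := integrable_finite_cst y.
have fin := integrable_fin_num measurableT intc.
suff m0 : m L = 0%E.
  have : m (L `|` ~` L) = (m L + m (~` L))%E.
    by apply: measureU; rewrite ?setICr//; exact: measurableC.
  by rewrite setUv mT m0 mL0 adde0 => -[r0']; rewrite r0' ltxx in r0.
have mh : measurable_fun setT (fun t => (y - clamp t)%:E).
  by apply/measurable_EFinP; apply: measurable_funB; [exact: measurable_cst|].
have : (\int[m]_t `|(y - clamp t)%:E| = 0)%E.
  rewrite (eq_integral (fun t => (EFin \o cst y) t - (EFin \o clamp) t)%E);
    last first.
    move=> t _; rewrite /= ger0_norm ?EFinB//.
    by rewrite subr_ge0; case/andP: (clamp_bounds t).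
  rewrite integralB// integral_finite_cst -[X in (_ - X)%E]fineK//.
  by rewrite -integral_clamp eq subee.
move/(ae_eq_integral_abs _ _ mh).1 => [//|N [mN N0 sub]].
apply: (@subset_measure0 _ _ _ m _ N) => // t Lt;
  apply: sub => /= /(_ I) [] /eqP.
by rewrite clampE// subr_eq0 => /eqP yt; have := Ly _ Lt; rewrite yt ltxx.
Qed.

End MeanBounds.

(** * Calculus of projection-valued measures *)

Section SpectralCalculus.
Import HBNNSimple.
Variables (R : realType) (H : lmodType R[i]) (V : set H) (b : H -> H -> R[i]).
Variable E : set R -> H -> H.
Local Notation Re := (@complex.Re R).
Hypothesis hb : hform V b.
Hypothesis bpos : forall x, V x -> x != 0 -> 0 < Re (b x x).
Hypothesis hE : projection_valued_measure V b E.
Let sV := hform_subspace hb.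

Lemma pd_ge0 x : V x -> 0 <= Re (b x x).
Proof.
move=> Vx; have [->|/(bpos Vx)/ltW//] := eqVneq x 0.
by rewrite (hform0l hb)//; exact: subspace0.
Qed.

Lemma pd_eq0 x : V x -> Re (b x x) = 0 -> x = 0.
Proof.
by move=> Vx bx; have [//|/(bpos Vx)] := eqVneq x 0; rewrite bx ltxx.
Qed.

Lemma pd_eq0_small x : V x -> (forall d, 0 < d -> Re (b x x) <= d) -> x = 0.
Proof.
move=> Vx small; apply: pd_eq0 => //; apply/eqP.
by rewrite eq_le pd_ge0// andbT; apply/ler_addgt0Pl => d /small; rewrite addr0.
Qed.

Lemma pvmD L u v : measurable L -> V u -> V v -> E L (u + v) = E L u + E L v.
Proof.
by move=> mL Vu Vv; rewrite -[u in LHS]scale1r (pvm_linear hE)// scale1r.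
Qed.

Lemma pvm0 L : measurable L -> E L 0 = 0.
Proof.
move=> mL; have V0 := subspace0 sV; have := pvmD mL V0 V0.
by rewrite addr0 => /eqP; rewrite -subr_eq subrr eq_sym => /eqP.
Qed.

Lemma pvmZ L c u : measurable L -> V u -> E L (c *: u) = c *: E L u.
Proof.
move=> mL Vu; have V0 := subspace0 sV.
by rewrite -[c *: u]addr0 (pvm_linear hE)// pvm0// addr0.
Qed.

Lemma pvmB L u v : measurable L -> V u -> V v -> E L (u - v) = E L u - E L v.
Proof.
by move=> mL Vu Vv; rewrite -scaleN1r pvmD ?pvmZ ?scaleN1r//;
  exact: (subspaceN sV).
Qed.

Lemma pvm_idem L u : measurable L -> V u -> E L (E L u) = E L u.
Proof. by move=> mL Vu; rewrite -(pvm_setI hE)// setIid. Qed.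

Lemma pvm_sqr L u : measurable L -> V u -> b (E L u) u = b (E L u) (E L u).
Proof.
move=> mL Vu; rewrite -[in LHS](pvm_idem mL Vu) (pvm_selfadjoint hE)//.
exact: (pvm_stable hE mL Vu).
Qed.

Lemma quad_measureE L u : measurable L -> V u ->
  quad_measure b E u L = (Re (b (E L u) (E L u)))%:E.
Proof. by move=> mL Vu; rewrite /quad_measure pvm_sqr. Qed.

Let mass u (L : set R) : \bar R :=
  if `[< measurable L >] then quad_measure b E u L else 0%E.

(* [quad_measure] need not be nonnegative on sets that are not measurable *)
Lemma quad_measure_integral u : V u ->
  exists2 m : {measure set R -> \bar R},
    (forall L, measurable L -> m L = quad_measure b E u L) &
    forall f : R -> \bar R, (\int[quad_measure b E u]_t f t = \int[m]_t f t)%E.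
Proof.
move=> Vu.
have massE L : measurable L -> mass u L = quad_measure b E u L.
  by move=> mL; rewrite /mass; case: asboolP.
have mass0 : mass u set0 = 0%E.
  by rewrite massE// /quad_measure (pvm_set0 hE)// (hform0l hb).
have mass_ge0 L : (0 <= mass u L)%E.
  rewrite /mass; case: asboolP => // mL; rewrite quad_measureE// lee_fin.
  by apply: pd_ge0; exact: (pvm_stable hE mL Vu).
have mass_sigma : semi_sigma_additive (mass u).
  move=> F mF tF mUF; rewrite massE//.
  rewrite (_ : (fun n => _) = (fun n => \sum_(0 <= i < n) quad_measure b E u (F
    i))%E).
    exact: (pvm_sigma_additive hE Vu).
  by apply/funext => n; apply: eq_bigr => i _; rewrite massE.
pose mm := isMeasure.Build _ _ _ _ mass0 mass_ge0 mass_sigma.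
pose m : {measure set R -> \bar R} := HB.pack (mass u) mm.
exists m => //.
(* Integrals are built from suprema over simple functions, and these evaluate the set function on
   measurable level sets only, where [mass u] and [quad_measure] coincide. *)
have sE (h : {nnsfun R >-> R}) : sintegral (quad_measure b E u) h = sintegral m
  h.
  rewrite /sintegral; apply: eq_fsbigr => x _; rewrite /= massE//.
have nnE f : ereal_sup [set sintegral (quad_measure b E u) h |
      h in [set h : {nnsfun R >-> R} | forall x, ((h x)%:E <= f x)%E]] =
    ereal_sup [set sintegral m h |
      h in [set h : {nnsfun R >-> R} | forall x, ((h x)%:E <= f x)%E]].
  by congr (ereal_sup _); apply/seteqP; split=> _ [g gf <-]; exists g.
by move=> f; rewrite /integral !nnE.
Qed.

Lemma pvm_sub L M x : measurable L -> measurable M -> V x ->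
  E L x = x -> L `<=` M -> E M x = x.
Proof.
move=> mL mM Vx Lx LM.
by rewrite -{1}Lx -(pvm_setI hE)// setIC (setIidl LM).
Qed.

Lemma pvm_disj L M x : measurable L -> measurable M -> V x ->
  E L x = x -> L `&` M = set0 -> E M x = 0.
Proof.
move=> mL mM Vx Lx LM.
by rewrite -Lx -(pvm_setI hE)// setIC LM (pvm_set0 hE).
Qed.

Lemma pvm_orth L M x y : measurable L -> measurable M -> V x -> V y ->
  E L x = x -> E M y = y -> L `&` M = set0 -> b x y = 0.
Proof.
move=> mL mM Vx Vy Lx My LM.
rewrite -Lx (pvm_selfadjoint hE)// (pvm_disj mM mL Vy My) 1?setIC//.
exact: (hform0r hb).
Qed.

(** Only the scalar measures are assumed additive. The defect [z] is fixed by [E (L]|[M)] and killed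
    by [E L] and [E M], so additivity of its own measure gives [b z z = 0]. *)
Lemma pvm_setU L M u : measurable L -> measurable M -> V u ->
  L `&` M = set0 -> E (L `|` M) u = E L u + E M u.
Proof.
move=> mL mM Vu LM; have mLM : measurable (L `|` M) by exact: measurableU.
have VL := pvm_stable hE mL Vu; have VM := pvm_stable hE mM Vu.
have VLM := pvm_stable hE mLM Vu.
set z := E (L `|` M) u - (E L u + E M u).
have Vz : V z by apply: subspaceB => //; exact: subspaceD.
have zLM : E (L `|` M) z = z.
  rewrite /z pvmB ?pvmD// ?pvm_idem//; last exact: subspaceD.
  by rewrite -!(pvm_setI hE)// (setIidr (@subsetUl _ L M)) (setIidr (@subsetUr
    _ L M)).
have zL : E L z = 0.
  rewrite /z pvmB ?pvmD// ?pvm_idem//; last exact: subspaceD.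
  rewrite -!(pvm_setI hE)// (setIidl (@subsetUl _ L M)) LM.
  by rewrite (pvm_set0 hE)// addr0 subrr.
have zM : E M z = 0.
  rewrite /z pvmB ?pvmD// ?pvm_idem//; last exact: subspaceD.
  rewrite -!(pvm_setI hE)// (setIidl (@subsetUr _ L M)) (setIC M) LM.
  by rewrite (pvm_set0 hE)// add0r subrr.
apply/eqP; rewrite -subr_eq0 -/z; apply/eqP; apply: pd_eq0 => //.
have [m mE _] := quad_measure_integral Vz.
have : m (L `|` M) = (m L + m M)%E by apply: measureU.
rewrite !mE// /quad_measure zLM zL zM (hform0l hb)//= => -[->].
by rewrite addr0.
Qed.

Lemma pvm_compl L u : measurable L -> V u -> u = E L u + E (~` L) u.
Proof.
move=> mL Vu; rewrite -pvm_setU ?setICr ?setUv ?(pvm_setT hE)//.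
exact: measurableC.
Qed.

Lemma pvm_compl_fix L u : measurable L -> V u -> E (~` L) u = 0 -> E L u = u.
Proof. by move=> mL Vu Lu; rewrite [RHS](pvm_compl mL Vu) Lu addr0. Qed.

Lemma pvm_sqr_le L u : measurable L -> V u ->
  Re (b (E L u) (E L u)) <= Re (b u u).
Proof.
move=> mL Vu; have [m mE _] := quad_measure_integral Vu.
rewrite -lee_fin -quad_measureE// -mE//.
have -> : (Re (b u u))%:E = m setT.
  by rewrite mE// /quad_measure (pvm_setT hE).
by apply: le_measure; rewrite ?inE//; exact: subsetT.
Qed.

(** Continuity from above of the finite measure of [u]: the complements of [[- k, k]] decrease to
    the empty set. *)
Lemma pvm_tail u d : V u -> 0 < d ->
  exists k : nat, Re (b (E (~` `[- k%:R, k%:R]) u) (E (~` `[- k%:R, k%:R]) u))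
    < d.
Proof.
move=> Vu d0; have [m mE _] := quad_measure_integral Vu.
pose F (k : nat) : set R := ~` `[- k%:R, k%:R].
have mF k : measurable (F k) by apply: measurableC.
have capF : \bigcap_k F k = set0.
  rewrite -subset0 => t Ft; apply: (Ft (Num.trunc `|t|).+1 I).
  by rewrite /= in_itv /= -ler_norml ltW// truncnS_gt.
have F0 : (m (F 0%N) < +oo)%E by rewrite mE// /quad_measure ltry.
have Fdec : {homo F : n k / (n <= k)%N >-> (k <= n)%O}.
  move=> n k nk; apply/subsetPset => t /=; apply: contra_not.
  rewrite /= !in_itv /= -!ler_norml => /le_trans; apply.
  by rewrite ler_nat.
have := nonincreasing_cvg_mu F0 mF _ Fdec.
rewrite capF measure0 => /(_ measurable0).
move=> /fine_cvgP[_ /cvgrPdist_lt/(_ _ d0)[N _ /(_ N (leqnn N))]].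
rewrite /= sub0r normrN mE// quad_measureE//= => lt; exists N.
exact: le_lt_trans (ler_norm _) lt.
Qed.

(** The density argument for vectors outside the operator domain: the truncation [y'] has bounded
    spectral support, so [op_dom_bounded] applies to it. *)
Lemma pvm_approx M y d : measurable M -> V y -> E M y = y -> 0 < d ->
  exists k : nat, let y' := E (M `&` `[- k%:R, k%:R]) y in
    Re (b (y - y') (y - y')) < d.
Proof.
move=> mM Vy My d0; have [k yk] := pvm_tail Vy d0; exists k => /=.
have -> // : y - E (M `&` `[- k%:R, k%:R]) y = E (~` `[- k%:R, k%:R]) y.
rewrite setIC (pvm_setI hE)// My {1}(@pvm_compl `[- k%:R, k%:R]%classic y)//.
by rewrite addrC addKr.
Qed.


End SpectralCalculus.

(** * Operators generated by a form, and Glazman's lemma *)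

Section FormOperator.
Variables (R : realType) (H : lmodType R[i]) (V : set H) (b : H -> H -> R[i]).
Variables (E : set R -> H -> H) (T : H -> H -> Prop).
Variables (W : set H) (p : H -> H -> R[i]) (lb : R).
Local Notation Re := (@complex.Re R).
Hypothesis hb : hform V b.
Hypothesis bpos : forall x, V x -> x != 0 -> 0 < Re (b x x).
Hypothesis hT : spectral_measure V b E T.
Hypotheses (WV : W `<=` V) (hp : hform W p).
Hypothesis Tlin : forall c u f v g, T u f -> T v g ->
  T (c *: u + v) (c *: f + g).
Hypothesis TW : forall u f, T u f -> W u /\ forall v, W v -> b f v = p u v.
Hypothesis p_lb : forall u, W u -> lb * Re (b u u) <= Re (p u u).
Let hE := sm_pvm hT.
Let sV := hform_subspace hb.
Let sW := hform_subspace hp.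

Lemma opV u f : T u f -> V f.
Proof. by move=> /(sm_eq hT)[]. Qed.

(** The measure of [u] is finite with finite second moment, and [|t| <= t ^+ 2 + 1]. *)
Lemma op_integrable u f (m : {measure set R -> \bar R}) :
  T u f -> (forall L, measurable L -> m L = quad_measure b E u L) ->
  (forall g : R -> \bar R, (\int[quad_measure b E u]_t g t = \int[m]_t g t)%E)
    ->
  m.-integrable setT (EFin \o id).
Proof.
move=> Tuf mE intE.
have [Vu u2] : V u /\ (\int[quad_measure b E u]_t (t ^+ 2)%:E < +oo)%E.
  by apply/(sm_dom hT); exists f.
have mT : m setT = (Re (b u u))%:E.
  by rewrite mE// /quad_measure (pvm_setT hE).
have int2 : m.-integrable setT (EFin \o (fun t : R => t ^+ 2)).
  apply/integrableP; split.
    by apply/measurable_EFinP; apply: measurable_funX.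
  under eq_integral do rewrite /= ger0_norm ?sqr_ge0//.
  by rewrite -intE.
apply: (le_integrable _ _ _
  (integrableD measurableT int2 (integrable_finite_cst mT 1))) => //.
  by apply/measurable_EFinP.
move=> t _; rewrite /= lee_fin [leRHS]ger0_norm ?addr_ge0 ?sqr_ge0//.
rewrite -real_normK ?num_real//; set s := `|t|.
by have := sqr_ge0 (s - 1); have := sqr_ge0 s; nra.
Qed.

Lemma quad_measureD x y L M N : measurable L -> measurable M -> measurable N ->
  V x -> V y -> E L x = x -> E M y = y -> L `&` M = set0 ->
  quad_measure b E (x + y) N =
    (quad_measure b E x N + quad_measure b E y N)%E.
Proof.
move=> mL mM mN Vx Vy Lx My LM.
have Vxy := subspaceD sV Vx Vy.
have VNx := pvm_stable hE mN Vx; have VNy := pvm_stable hE mN Vy.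
have LNx : E L (E N x) = E N x.
  by rewrite -(pvm_setI hE)// setIC (pvm_setI hE)// Lx.
have MNy : E M (E N y) = E N y.
  by rewrite -(pvm_setI hE)// setIC (pvm_setI hE)// My.
rewrite /quad_measure -EFinD (pvmD hE)//; congr (_%:E).
rewrite (hformDl hb)// !(hformDr hb)//.
rewrite (pvm_orth hb hE mL mM VNx Vy LNx My LM).
rewrite (pvm_orth hb hE mM mL VNy Vx MNy Lx) 1?setIC//.
by rewrite add0r addr0 Re_add.
Qed.

(* The measures of [x], [y] and [x + y] add up, so the quadratic form of [T]
   is additive at [x + y] and its cross term vanishes. *)
Lemma op_cross_dom x f y g L M : measurable L -> measurable M ->
  T x f -> T y g -> E L x = x -> E M y = y -> L `&` M = set0 ->
  Re (b f y) = 0.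
Proof.
move=> mL mM Txf Tyg Lx My LM.
have Vf := opV Txf; have Vg := opV Tyg.
have [Wx px] := TW Txf; have [Wy py] := TW Tyg.
have Vx := WV Wx; have Vy := WV Wy; have Vxy := subspaceD sV Vx Vy.
have Txyfg : T (x + y) (f + g).
  by rewrite -[x]scale1r -[f]scale1r; exact: Tlin.
have [m1 m1E int1] := quad_measure_integral hb bpos hE Vx.
have [m2 m2E int2] := quad_measure_integral hb bpos hE Vy.
have [m mE int] := quad_measure_integral hb bpos hE Vxy.
have i1 := op_integrable Txf m1E int1; have i2 := op_integrable Tyg m2E int2.
have [_] := sm_eq hT Txyfg; have [_] := sm_eq hT Txf; have [_] := sm_eq hT Tyg.
rewrite int1 int2 int => gy fx fgxy.
have intD : (\int[m]_t t%:E = \int[m1]_t t%:E + \int[m2]_t t%:E)%E.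
  rewrite -(integral_measure_add measurableT i1 i2).
  apply: eq_measure_integral => A mA _.
  rewrite [RHS](measure_addE m1 m2) mE// m1E// m2E//.
  exact: (quad_measureD mL mM).
have intD' : fine (\int[m]_t t%:E)%E =
    fine (\int[m1]_t t%:E)%E + fine (\int[m2]_t t%:E)%E.
  rewrite intD; apply: fineD; [exact: integrable_fin_num i1|].
  exact: integrable_fin_num i2.
(* As [p] is hermitian, [b g x] is the conjugate of [b f y]. The vanishing sum therefore controls
   just the real part. *)
have : b f y + b g x = 0.
  move: fgxy; rewrite (hformDl hb)// !(hformDr hb)// fx gy intD' rmorphD /= =>
    /eqP; rewrite -subr_eq0 => /eqP e0.
  by rewrite -[RHS]e0; ring.
rewrite py// (hformC hp)// -px// => /(congr1 Re).
by rewrite Re_add Re_conjc => /eqP; rewrite -mulr2n mulrn_eq0 => /eqP.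
Qed.

Lemma opZ c u f : T u f -> T (c *: u) (c *: f).
Proof.
move=> Tuf; have := Tlin (c - 1) Tuf Tuf.
by rewrite !scalerBl !scale1r !subrK.
Qed.

(** The imaginary part is the real part for [- 'i *: y], which has the same spectral support as
    [y]. *)
Lemma op_cross_bounded x f y g L M : measurable L -> measurable M ->
  T x f -> T y g -> E L x = x -> E M y = y -> L `&` M = set0 -> b f y = 0.
Proof.
move=> mL mM Txf Tyg Lx My LM; have Vf := opV Txf.
have Vy := WV (TW Tyg).1.
apply: complex_eq0P; first exact: (op_cross_dom mL mM Txf Tyg).
have := op_cross_dom mL mM Txf (opZ (- 'i%C) Tyg) Lx.
rewrite (pvmZ hb hE)// My => /(_ erefl LM).
rewrite (hformZr hb)//; have -> // : (- 'i%C : R[i])^*%R = 'i%C.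
by rewrite conj_conjc; apply/eqP; rewrite eq_complex /= oppr0 opprK !eqxx.
Qed.

(** The measure of [u] is carried by [L], where [t ^+ 2] is bounded. *)
Lemma op_dom_bounded L (x y : R) u : measurable L -> x <= y ->
  (forall t, L t -> x <= t <= y) -> V u -> E L u = u -> exists f, T u f.
Proof.
move=> mL xy Lxy Vu Lu; apply/(sm_dom hT); split=> //.
have [m mE ->] := quad_measure_integral hb bpos hE Vu.
apply: (second_moment_finite (m := m) (r := Re (b u u)) _ xy mL _ Lxy).
  by rewrite mE// /quad_measure (pvm_setT hE).
rewrite mE; last exact: measurableC.
rewrite /quad_measure (pvm_disj hE mL _ Vu Lu) ?setICr//;
  last exact: measurableC.
by rewrite (hform0l hb).
Qed.

Lemma op_mean_bounds L (x y : R) u f : measurable L -> x <= y ->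
  (forall t, L t -> x <= t <= y) -> T u f -> E L u = u ->
  x * Re (b u u) <= Re (b f u) <= y * Re (b u u) /\
  ((forall t, L t -> t < y) -> u != 0 -> Re (b f u) < y * Re (b u u)).
Proof.
move=> mL xy Lxy Tuf Lu; have Vu := WV (TW Tuf).1.
have [_ ->] := sm_eq hT Tuf.
have [m mE ->] := quad_measure_integral hb bpos hE Vu.
have mT : m setT = (Re (b u u))%:E.
  by rewrite mE// /quad_measure (pvm_setT hE).
have mL0 : m (~` L) = 0%E.
  rewrite mE; last exact: measurableC.
  rewrite /quad_measure (pvm_disj hE mL _ Vu Lu) ?setICr//;
    last exact: measurableC.
  by rewrite (hform0l hb).
split; first exact: (mean_bounds mT xy mL mL0 Lxy).
move=> Ly u0; apply: (mean_lt_sup mT xy mL mL0 Lxy) => //.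
exact: bpos.
Qed.

Lemma b_Re_eq0_approx f y : V f -> V y ->
  (forall d, 0 < d -> exists2 z, V z & Re (b z z) <= d /\ b f y = b f z) ->
  Re (b f y) = 0.
Proof.
move=> Vf Vy app; have ge0 w (Vw : V w) := pd_ge0 hb bpos Vw.
apply/eqP/negPn/negP => r0; set r := Re (b f y) in r0.
(* With weight [s], [Re_amgm] bounds [2 * Re (b f w)] by [s * (Re (b f f) + 1) = |r|] once
   [Re (b w w) <= s * s]. Taking [w = z] and [w = - z] gives [2 |r| <= |r|]. *)
pose C := Re (b f f) + 1; have C0 : 0 < C by rewrite ltr_wpDl ?ge0.
pose s := `|r| / C; have s0 : 0 < s by rewrite divr_gt0 ?normr_gt0.
have [z Vz [zs yz]] := app _ (mulr_gt0 s0 s0).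
have bound w : V w -> Re (b w w) <= s * s -> 2 * Re (b f w) <= `|r|.
  move=> Vw ws; apply: le_trans (Re_amgm hb ge0 s0 Vf Vw) _.
  rewrite -[leRHS](divfK (lt0r_neq0 C0)) -/s /C mulrDr lerD2l mulr1.
  by rewrite ler_pdivrMl.
have h1 := bound _ Vz zs.
have := bound _ (subspaceN sV Vz); rewrite !(hformNr hb)//;
  last exact: subspaceN.
rewrite (hformNl hb)// opprK => /(_ zs); rewrite Re_opp => h2.
rewrite -yz -/r in h1 h2.
have : 0 < `|r| by rewrite normr_gt0.
by case: (ler0P r) h1 h2 => _; lra.
Qed.

Lemma b_eq0_approx f y : V f -> V y ->
  (forall d, 0 < d -> exists2 z, V z & Re (b z z) <= d /\ b f y = b f z) ->
  b f y = 0.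
Proof.
move=> Vf Vy app; have Vif := subspaceZ sV 'i%C Vf.
apply: (hform_eq0_Re hb) => //; apply: b_Re_eq0_approx => //.
move=> d /app[z Vz [zd fz]]; exists z => //; split => //.
by rewrite !(hformZl hb)// fz.
Qed.

(** The pairing of [f] with every truncation [y'] of [y] vanishes, so [b f y = b f (y - y')] with
    [y - y'] arbitrarily small. *)
Lemma op_cross x f y L M : measurable L -> measurable M ->
  T x f -> V y -> E L x = x -> E M y = y -> L `&` M = set0 -> b f y = 0.
Proof.
move=> mL mM Txf Vy Lx My LM; have Vf := opV Txf.
apply: b_eq0_approx => // d d0.
have [k] := pvm_approx hb bpos hE mM Vy My d0.
have mMk : measurable (M `&` `[- k%:R, k%:R]) by exact: measurableI.
set y' := E _ _ => /= yy'; have Vy' : V y' := pvm_stable hE mMk Vy.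
exists (y - y'); first exact: subspaceB.
split; first exact: ltW.
have y'E : E (M `&` `[- k%:R, k%:R]) y' = y' by rewrite /y' (pvm_idem hE).
have [g Ty'g] : exists g, T y' g.
  apply: (op_dom_bounded mMk _ _ Vy' y'E (x := - k%:R) (y := k%:R)).
    by rewrite ge0_cp ?ler0n.
  by move=> t [_]; rewrite /= in_itv.
rewrite (hformBr hb)// [X in _ - X](op_cross_bounded mL mMk Txf Ty'g Lx y'E)
  ?subr0//.
by rewrite setIA LM set0I.
Qed.

Lemma op_form_cross x f y L M : measurable L -> measurable M ->
  T x f -> W y -> E L x = x -> E M y = y -> L `&` M = set0 -> p x y = 0.
Proof.
move=> mL mM Txf Wy Lx My LM; rewrite -(TW Txf).2//.
exact: (op_cross mL mM Txf (WV Wy)).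
Qed.

Lemma op_form_bounds L (x y : R) u : measurable L -> x <= y ->
  (forall t, L t -> x <= t <= y) -> V u -> E L u = u ->
  W u /\ x * Re (b u u) <= Re (p u u) <= y * Re (b u u).
Proof.
move=> mL xy Lxy Vu Lu; have [f Tuf] := op_dom_bounded mL xy Lxy Vu Lu.
have [Wu fu] := TW Tuf; split=> //.
by rewrite -fu//; have [] := op_mean_bounds mL xy Lxy Tuf Lu.
Qed.

Lemma pvm_eq0_bounded (L : set R) u : measurable L -> V u ->
  (forall k : nat, E (L `&` `[- k%:R, k%:R]) u = 0) -> E L u = 0.
Proof.
move=> mL Vu z; have VL := pvm_stable hE mL Vu.
apply: (pd_eq0_small hb bpos VL) => d d0.
have [k] := pvm_approx hb bpos hE mL VL (pvm_idem hE mL Vu) d0.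
have mLk : measurable (L `&` `[- k%:R, k%:R]) by exact: measurableI.
by rewrite /= -(pvm_setI hE)// setIAC setIid z subr0 => /ltW.
Qed.

(** A nonzero vector [v] of a bounded piece of this spectral subspace would satisfy both
    [p v v <= x * b v v] and [lb * b v v <= p v v], although [x < lb]. *)
Lemma pvm_below_lb (L : set R) (x : R) u : x < lb -> measurable L ->
  (forall t, L t -> t <= x) -> V u -> E L u = 0.
Proof.
move=> xlb mL Lx Vu; apply: pvm_eq0_bounded => // k.
have mLk : measurable (L `&` `[- k%:R, k%:R]) by exact: measurableI.
have Vv := pvm_stable hE mLk Vu; set v := E _ u in Vv *.
have vE : E (L `&` `[- k%:R, k%:R]) v = v by rewrite /v (pvm_idem hE).
have [v0|v0] := eqVneq v 0; first by [].
(* The minimum keeps the window ordered when [- k] exceeds [x], in which case [L] misses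
   [[- k, k]]. *)
pose x0 := Num.min x (- k%:R).
have x0x : x0 <= x by rewrite ge_min lexx.
have [||Wv /andP[_]] := op_form_bounds (x := x0) (y := x) mLk _ _ Vv vE => //.
  move=> t [/Lx tx]; rewrite /= in_itv /= => /andP[kt _].
  by rewrite tx andbT ge_min kt orbT.
rewrite leNgt => /negP[]; apply: lt_le_trans (p_lb Wv).
by rewrite ltr_pM2r// bpos.
Qed.

Lemma pvm_cut (L : set R) (x : R) u : x < lb -> measurable L -> V u ->
  E L u = u -> E (L `&` `]x, +oo[) u = u.
Proof.
move=> xlb mL Vu Lu; rewrite (pvm_setI hE)//.
suff -> : E `]x, +oo[ u = u by [].
apply: (pvm_compl_fix hb bpos hE) => //.
apply: (pvm_below_lb xlb) => //; first exact: measurableC.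
by move=> t /=; rewrite in_itv /= andbT => /negP; rewrite -leNgt.
Qed.

(** The half-line is in effect a bounded window, as no spectrum lies below [lb]. The cut is strictly
    below [lb], as [pvm_cut] requires, and at most [mu]. *)
Lemma op_dom_below mu u : V u -> E `]-oo, mu[ u = u ->
  exists2 f, T u f & u != 0 -> Re (b f u) < mu * Re (b u u).
Proof.
move=> Vu uE; pose x := Num.min (lb - 1) mu.
have xlb : x < lb by rewrite gt_min ltrBlDr ltrDl ltr01.
have xmu : x <= mu by rewrite ge_min lexx orbT.
have mI : measurable (`]-oo, mu[ `&` `]x, +oo[ : set R) by exact: measurableI.
have uE' := pvm_cut xlb (measurable_itv _) Vu uE.
have bnd t : (`]-oo, mu[ `&` `]x, +oo[ : set R) t -> x <= t <= mu.
  by case; rewrite /= !in_itv /= andbT => /ltW -> /ltW ->.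
have [f Tuf] := op_dom_bounded mI xmu bnd Vu uE'.
exists f => // u0; have [_] := op_mean_bounds mI xmu bnd Tuf uE'; apply=> //.
by move=> t []; rewrite /= in_itv.
Qed.

(** Here [u] is only in the form domain. Its truncation [v] satisfies the bound, [p] and [b] have no
    cross terms between [v] and [w = u - v], and [p w w >= lb * b w w] makes the remainder
    negligible. *)
Lemma form_ge_above mu u : W u -> E `[mu, +oo[ u = u ->
  mu * Re (b u u) <= Re (p u u).
Proof.
move=> Wu uE; have Vu := WV Wu.
have mM : measurable (`[mu, +oo[ : set R) by [].
(* The error is [(mu - lb) * Re (b w w)]; the summand 1 makes the divisor positive. *)
have C0 : 0 < `|mu| + `|lb| + 1 by rewrite ltr_wpDl// addr_ge0.
apply/ler_addgt0Pl => d d0.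
have [k] := pvm_approx hb bpos hE mM Vu uE (divr_gt0 d0 C0).
have mMk : measurable (`[mu, +oo[ `&` `[- k%:R, k%:R] : set R).
  exact: measurableI.
set v := E _ _ => /= uv; have Vv : V v := pvm_stable hE mMk Vu.
have vE : E (`[mu, +oo[ `&` `[- k%:R, k%:R]) v = v by rewrite /v (pvm_idem hE).
have muk : mu <= Num.max mu k%:R by rewrite le_max lexx.
have bnd t : (`[mu, +oo[ `&` `[- k%:R, k%:R] : set R) t ->
    mu <= t <= Num.max mu k%:R.
  case; rewrite /= !in_itv /= andbT => -> /andP[_ tk] /=.
  by rewrite le_max tk orbT.
have [f Tvf] := op_dom_bounded mMk muk bnd Vv vE.
have [Wv /andP[pv _]] := op_form_bounds mMk muk bnd Vv vE.
set w := u - v; have Ww : W w by exact: subspaceB.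
have Vw := WV Ww.
have mC := measurableC mMk.
have wE : E (~` (`[mu, +oo[ `&` `[- k%:R, k%:R])) w = w.
  rewrite /w {1 2}(pvm_compl hb bpos hE mMk Vu) -/v [v + _]addrC addrK.
  exact: (pvm_idem hE).
have -> : u = v + w by rewrite /w addrC subrK.
rewrite (Re_sqrD hb)// (Re_sqrD hp)//.
rewrite (op_form_cross mMk mC Tvf Ww vE wE) ?setICr//.
rewrite (pvm_orth hb hE mMk mC Vv Vw vE wE) ?setICr//= mulr0 !addr0.
have := p_lb Ww; have w0 := pd_ge0 hb bpos Vw.
move: uv; rewrite -/w ltr_pdivlMr//.
have := ler_norm mu; have := ler_norm (- lb); rewrite normrN.
by nra.
Qed.

(** The projection is injective on the span of a negative family: a vector killed by it has spectral
    support in [[mu, +oo[], where [form_ge_above] forbids negativity. Conversely the range of the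
    projection lies in [W] and the form is negative there, so [gram_schmidt] applies. *)
Lemma glazman mu :
  sup_size R (neg_sizes W (fun u v => p u v - mu%:C%C * b u v)) =
  dimE (E `]-oo, mu[ @` V).
Proof.
have mL : measurable (`]-oo, mu[ : set R) by [].
have hbW : hform W b by exact: hform_sub hb _ _.
set s := (fun u v => _); have hs : hform W s by exact: hformB.
have ReS u : Re (s u u) = Re (p u u) - mu * Re (b u u).
  by rewrite /s Re_sub Re_mulC.
rewrite /sup_size /dimE; congr ereal_sup; congr image.
apply/seteqP; split=> n.
- move=> [e ne]; exists (fun i : 'I_n => E `]-oo, mu[ (e i)).
    by move=> i; exists (e i) => //; apply: WV; exact: ne.1.
  move=> c cE i; apply/eqP/negPn/negP => ci.
  have := neg_family_sqr_lt0 hs ne (c := c).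
  set x := \sum_(i < n) c i *: e i => /(_ (ex_intro _ i ci)).
  have Wx : W x by apply: subspace_sum => // j; exact: ne.1.
  have Ex : E `]-oo, mu[ x = 0.
    pose P (u z : H) := V u /\ E `]-oo, mu[ u = z.
    suff [] : P x (\sum_i c i *: E `]-oo, mu[ (e i)) by rewrite cE.
    apply: (big_rec2 P); first by split; [exact: subspace0|exact: (pvm0 hb hE)].
    move=> j z u _ [Vu <-]; have Vej := WV (ne.1 _ (ltn_ord j)).
    split; first exact: subspaceP.
    by rewrite (pvm_linear hE).
  rewrite ReS ltNge subr_ge0 form_ge_above//.
  apply: (pvm_compl_fix hb bpos hE) => //; first exact: WV.
  by rewrite setCitvr.
- move=> [f Vf lf].
  have fE i : V (f i) /\ E `]-oo, mu[ (f i) = f i.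
    have [u Vu <-] := Vf i; split; first exact: (pvm_stable hE mL Vu).
    exact: (pvm_idem hE mL Vu).
  apply: (gram_schmidt hs (f := f)).
    move=> c c0; have := lin_indep_neq0 lf c0; set x := \sum_i _ => x0.
    have [Vx Ex] : V x /\ E `]-oo, mu[ x = x.
      apply: (big_ind (fun x => V x /\ E `]-oo, mu[ x = x)).
      - by split; [exact: subspace0|exact: (pvm0 hb hE)].
      - move=> u v [Vu Eu] [Vv Ev]; split; first exact: subspaceD.
        by rewrite (pvmD hE)// Eu Ev.
      - move=> i _; have [Vfi Efi] := fE i; split; first exact: subspaceZ.
        by rewrite (pvmZ hb hE)// Efi.
    have [g Tg /(_ x0)] := op_dom_below Vx Ex.
    by rewrite ReS subr_lt0 (TW Tg).2//; exact: (TW Tg).1.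
  move=> i; have [Vfi Efi] := fE i.
  by have [g /TW[]] := op_dom_below Vfi Efi.
Qed.

End FormOperator.

(** * Spectral measures near points of the resolvent set *)

Section ResolventGaps.
Variables (R : realType) (H : lmodType R[i]) (V : set H) (b : H -> H -> R[i]).
Variables (E : set R -> H -> H) (T : H -> H -> Prop).
Variables (W : set H) (p : H -> H -> R[i]).
Local Notation Re := (@complex.Re R).
Hypothesis hb : hform V b.
Hypothesis bpos : forall x, V x -> x != 0 -> 0 < Re (b x x).
Hypothesis hT : spectral_measure V b E T.
Hypotheses (WV : W `<=` V) (hp : hform W p).
Hypothesis Tlin : forall c u f v g, T u f -> T v g ->
  T (c *: u + v) (c *: f + g).
Hypothesis TW : forall u f, T u f -> W u /\ forall v, W v -> b f v = p u v.
Let hE := sm_pvm hT.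
Let sV := hform_subspace hb.
Let sW := hform_subspace hp.

(* Polarization: the quadratic form of [T - x] on the range of
   [E ]x - d, x + d[] is bounded by [d], hence so is the norm of [T - x]. *)
Lemma op_sub_norm (x d : R) u h : 0 < d -> E `]x - d, x + d[ u = u -> T u h ->
  Re (b (h - x%:C%C *: u) (h - x%:C%C *: u)) <= d ^+ 2 * Re (b u u).
Proof.
move=> d0 uE Tuh; set L : set R := `]x - d, x + d[%classic in uE *.
have mL : measurable L by exact: measurable_itv.
have mC := measurableC mL.
have Vh := opV hT Tuh; have [Wu hu] := TW Tuh; have Vu := WV Wu.
have Vxu : V (x%:C%C *: u) by exact: (subspaceZ sV).
set f := h - _; have Vf : V f := subspaceB sV Vh Vxu.
(* The part of [f] in the complementary spectral subspace is orthogonal to [h] by [op_cross] and to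
   [u], hence to [f]. *)
have fE : E L f = f.
  apply: (pvm_compl_fix hb bpos hE mL Vf).
  have Vg := pvm_stable hE mC Vf; have gE := pvm_idem hE mC Vf.
  apply: (pd_eq0 bpos Vg); rewrite -(pvm_sqr hE mC Vf).
  rewrite (pvm_selfadjoint hE mC)// (hformBl hb)// (hformZl hb)//.
  rewrite (op_cross hb bpos hT WV hp Tlin TW mL mC Tuh Vg uE gE) ?setICr//.
  by rewrite (pvm_orth hb hE mL mC Vu Vg uE gE) ?setICr// mulr0 subr0.
(* Subtracting the form bounds at [u + c f] and [u - c f] gives [4 c F <= 2 d U + 2 d c^2 F]; the
   choice [d c = 1] turns this into [F <= d^2 U]. *)
pose c := d^-1; have dc : d * c = 1 by rewrite mulfV ?gt_eqF.
have Vcf : V (c%:C%C *: f) := subspaceZ sV c%:C%C Vf.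
have cfE : E L (c%:C%C *: f) = c%:C%C *: f by rewrite (pvmZ hb hE)// fE.
have xd : x - d <= x + d by rewrite lerBlDr -addrA lerDl addr_ge0// ltW.
have bnd t : L t -> x - d <= t <= x + d.
  by rewrite /L /= in_itv /= => /andP[/ltW -> /ltW ->].
have bounds v := op_form_bounds hb bpos hT WV TW mL xd bnd (u := v).
have [Wcf _] := bounds _ Vcf cfE.
have Wf : W f.
  have -> : f = d%:C%C *: (c%:C%C *: f).
    by rewrite scalerA -rmorphM /= dc scale1r.
  exact: subspaceZ.
have [|_ /andP[_ h1]] := bounds (u + c%:C%C *: f) (subspaceD sV Vu Vcf).
  by rewrite (pvmD hE)// uE cfE.
have [|_ /andP[h2 _]] := bounds (u - c%:C%C *: f) (subspaceB sV Vu Vcf).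
  by rewrite (pvmB hb hE)// uE cfE.
have puf : Re (p u f) = Re (b f f) + x * Re (b u f).
  rewrite -hu// (_ : h = f + x%:C%C *: u); last by rewrite subrK.
  by rewrite (hformDl hb)// Re_add (ReZl hb).
move: h1 h2; rewrite (Re_sqrD hp)// (Re_sqrB hp)// (Re_sqrD hb)// (Re_sqrB
  hb)//.
rewrite (Re_sqrZ hp)// (Re_sqrZ hb)// (ReZr hp)// (ReZr hb)// puf.
set F := Re (b f f); set U := Re (b u u); set B := Re (b u f).
set PF := Re (p f f); set PU := Re (p u u) => h1 h2.
have : 4 * c * F <= 2 * d * U + 2 * (d * c) * c * F by lra.
rewrite dc => h3.
have h4 : c * F <= d * U by lra.
by have := ler_wpM2l (ltW d0) h4; rewrite !mulrA dc mul1r expr2.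
Qed.

(** For [u] in the window, [op_sub_norm] gives [b u u <= M d^2 * b u u], and [d = 1 / (M + 1)] makes
    [M d^2 < 1]. *)
Lemma resolvent_gap (x M : R) : 0 <= M ->
  (forall u f, T u (f + x%:C%C *: u) -> Re (b u u) <= M * Re (b f f)) ->
  exists2 d, 0 < d & forall u, V u -> E `]x - d, x + d[ u = 0.
Proof.
move=> M0 res; have M1 : 0 < M + 1 by rewrite ltr_wpDl.
pose d := (M + 1)^-1; have d0 : 0 < d by rewrite invr_gt0.
exists d => // u0 Vu0; set L : set R := `]x - d, x + d[%classic.
have mL : measurable L by exact: measurable_itv.
have Vu := pvm_stable hE mL Vu0; have uE := pvm_idem hE mL Vu0.
set u := E L u0 in Vu uE *.
have xd : x - d <= x + d by rewrite lerBlDr -addrA lerDl addr_ge0// ltW.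
have bnd t : L t -> x - d <= t <= x + d.
  by rewrite /L /= in_itv /= => /andP[/ltW -> /ltW ->].
have [h Tuh] := op_dom_bounded hb bpos hT mL xd bnd Vu uE.
have fu := op_sub_norm d0 uE Tuh.
have := res u (h - x%:C%C *: u); rewrite subrK => /(_ Tuh) ufM.
apply: (pd_eq0 bpos Vu); apply/eqP; rewrite eq_le (pd_ge0 hb bpos Vu) andbT.
rewrite leNgt; apply/negP => u_gt0.
have : Re (b u u) <= M * d ^+ 2 * Re (b u u).
  by rewrite -mulrA; apply: le_trans ufM _; rewrite ler_wpM2l.
apply/negP; rewrite -ltNge gtr_pMl//.
have dM : (M + 1) * d = 1 by rewrite mulfV ?gt_eqF.
have -> : M * d ^+ 2 = (1 - d) * d by rewrite -dM; ring.
by nra.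
Qed.

(* The punctured interval is covered by countably many null intervals with
   rational end points. *)
Lemma punctured_gap (x e : R) :
  (forall y, 0 < `|y - x| < e ->
     exists2 d, 0 < d & forall u, V u -> E `]y - d, y + d[ u = 0) ->
  forall u, V u -> E (`]x - e, x + e[ `\ x) u = 0.
Proof.
move=> gaps u Vu; set A : set R := _ `\ x.
have mA : measurable A by exact: measurableD.
pose null (q : rat * rat) :=
  forall u, V u -> E `](ratr q.1 : R), ratr q.2[ u = 0.
pose F n : set R := if unpickle n is Some q then
  if `[< null q >] then `](ratr q.1 : R), ratr q.2[%classic else set0 else set0.
have [m mE _] := quad_measure_integral hb bpos hE Vu.
have : m.-negligible (\bigcup_n F n).
  apply: negligible_bigcup => n; rewrite /F.
  case: unpickle => [q|]; last exact: negligible_set0.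
  case: asboolP => [nq|_]; last exact: negligible_set0.
  have mI : measurable (`](ratr q.1 : R), ratr q.2[ : set R) by [].
  have m0 : m `](ratr q.1 : R), ratr q.2[%classic = 0%E.
    by rewrite mE// /quad_measure nq// (hform0l hb).
  exact: (negligibleP m mI).2 m0.
move=> negl; have : m A = 0%E.
  apply: (negligibleP m mA).1; apply: negligibleS negl => y.
  move=> [/=]; rewrite in_itv /= => /andP[xy yx] /eqP yNx.
  have [|d d0 dE] := gaps y.
    by rewrite normr_gt0 subr_eq0 yNx ltr_distl xy yx.
  have [r1] := @rat_in_itvoo R (y - d) y (ltac:(by rewrite gtrBl)).
  have [r2] := @rat_in_itvoo R y (y + d) (ltac:(by rewrite ltrDl)).
  rewrite !in_itv /= => /andP[yr2 r2y] /andP[yr1 r1y].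
  have nr : null (r1, r2).
    move=> v Vv /=.
    have m1 : measurable (`](ratr r1 : R), ratr r2[ : set R) by [].
    have Vw := pvm_stable hE m1 Vv; have wE := pvm_idem hE m1 Vv.
    rewrite -[LHS](pvm_sub hE m1 _ Vw wE (M := `]y - d, y + d[%classic))//.
      exact: dE.
    move=> t; rewrite /= !in_itv /= => /andP[r1t tr2].
    by rewrite (lt_trans yr1 r1t) (lt_trans tr2 r2y).
  exists (pickle (r1, r2)); first exact: I.
  rewrite /F pickleK; case: asboolP => [_|/(_ nr)//].
  by rewrite /= in_itv /= r1y.
rewrite mE// (quad_measureE hE)//; move=> [] /(pd_eq0 bpos); apply.
exact: (pvm_stable hE mA Vu).
Qed.

End ResolventGaps.

(** * Riesz representation *)

Section Riesz.
Variables (R : realType) (H : lmodType R[i]) (W : set H) (s : H -> H -> R[i]).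
Local Notation Re := (@complex.Re R).
Hypothesis hs : hform W s.
Hypothesis spos : forall v, W v -> 0 <= Re (s v v).
Hypothesis complete : forall u : nat -> H, (forall n, W (u n)) ->
  (forall e, 0 < e -> exists N, forall m n, (N <= m)%N -> (N <= n)%N ->
     Re (s (u m - u n) (u m - u n)) < e) ->
  exists2 w, W w & forall e, 0 < e -> exists N, forall n, (N <= n)%N ->
     Re (s (u n - w) (u n - w)) < e.
Variables (phi : H -> R[i]) (C : R).
Hypothesis phi_lin : forall c u v, W u -> W v ->
  phi (c *: u + v) = c^*%R * phi u + phi v.
(** Boundedness of [phi] in the form that minimization needs: [J] is at least [- C]. *)
Hypothesis phi_bound : forall v, W v -> 2 * Re (phi v) <= Re (s v v) + C.
Let sW := hform_subspace hs.
Let J v : R := Re (s v v) - 2 * Re (phi v).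

Let phi0 : phi 0 = 0.
Proof.
have W0 := subspace0 sW; have := phi_lin 1 W0 W0.
rewrite scale1r addr0 rmorph1 mul1r => /eqP.
by rewrite -subr_eq subrr eq_sym => /eqP.
Qed.

Let phiZ c v : W v -> phi (c *: v) = c^*%R * phi v.
Proof.
move=> Wv; rewrite -[c *: v]addr0 phi_lin ?phi0 ?addr0//; exact: subspace0.
Qed.

Let phiD u v : W u -> W v -> phi (u + v) = phi u + phi v.
Proof. by move=> Wu Wv; rewrite -[u in LHS]scale1r phi_lin// rmorph1 mul1r. Qed.

Let infJ : R := inf [set J v | v in W].

Let has_infJ : has_inf [set J v | v in W].
Proof.
split; first by exists (J 0); exists 0 => //; exact: subspace0.
exists (- C) => _ [v Wv <-]; rewrite /J.
by have := phi_bound Wv; lra.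
Qed.

Let infJ_le v : W v -> infJ <= J v.
Proof. by move=> Wv; apply: ge_inf; [exact: has_infJ.2|exists v]. Qed.

Let minimizing : exists u : nat -> H,
  (forall n, W (u n)) /\ forall n, J (u n) < infJ + n.+1%:R^-1.
Proof.
have ex n : exists v, W v /\ J v < infJ + n.+1%:R^-1.
  have n0 : 0 < n.+1%:R^-1 :> R by rewrite invr_gt0.
  by have [_ [v Wv <-] lt] := inf_adherent n0 has_infJ; exists v.
have [u uP] := choice ex.
by exists u; split=> n; have [] := uP n.
Qed.

(* The parallelogram identity makes minimizing sequences of [J] Cauchy. *)
Let J_parallelogram u v : W u -> W v ->
  Re (s (u - v) (u - v)) <= 2 * J u + 2 * J v - 4 * infJ.
Proof.
move=> Wu Wv; have Wuv := subspaceD sW Wu Wv.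
have Wh : W ((2^-1 : R)%:C%C *: (u + v)) by exact: subspaceZ.
have := infJ_le Wh; rewrite /J (Re_sqrZ hs)// phiZ// conj_realC Re_mulC.
rewrite phiD// Re_add (Re_sqrD hs)// (Re_sqrB hs)// expr2.
by move=> h; lra.
Qed.

Lemma riesz : exists2 w, W w & forall v, W v -> s w v = phi v.
Proof.
have [u [Wu Ju]] := minimizing.
have small (e : R) : 0 < e -> exists N, forall n, (N <= n)%N -> n.+1%:R^-1 < e.
  move=> e0; exists (Num.trunc e^-1) => n Nn.
  rewrite invf_plt ?posrE//; apply: lt_le_trans (truncnS_gt _) _.
  by rewrite ler_nat.
have [||w Ww uw] := complete (u := u) => //.
  move=> e e0; have [N Nsm] := small (e / 4) (divr_gt0 e0 (ltr0n _ 4)).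
  exists N => m n Nm Nn; apply: le_lt_trans (J_parallelogram (Wu m) (Wu n)) _.
  have := Ju m; have := Ju n; have := Nsm _ Nm; have := Nsm _ Nn.
  set x := m.+1%:R^-1; set y := n.+1%:R^-1; lra.
exists w => //.
have half h : W h -> 0 <= Re (s w h - phi h).
  move=> Wh; set K := Re (s h h); have K0 : 0 <= K by exact: spos.
  rewrite leNgt; apply/negP => neg.
  (* Moving [u n] by [t *: h] would gain [4 t^2 (1 + K)] in the linear term. The errors are [t^2 K]
     from curvature, [t^2] from the infimum and [t^2 (1 + K)] from replacing [w] by [u n], only half
     as much in total. *)
  pose t := - Re (s w h - phi h) / (2 + 2 * K).
  have K2 : 0 < 2 + 2 * K by lra.
  have t0 : 0 < t by rewrite divr_gt0 ?oppr_gt0.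
  have [N1 N1s] := small _ (mulr_gt0 t0 t0).
  have [N2 N2s] := uw _ (mulr_gt0 t0 t0).
  pose n := maxn N1 N2.
  have hn1 := N1s n (leq_maxl _ _); have hn2 := N2s n (leq_maxr _ _).
  have Wth : W (t%:C%C *: h) by exact: subspaceZ.
  have Wd : W (u n - w) by exact: subspaceB.
  have := infJ_le (subspaceD sW (Wu n) Wth).
  rewrite /J (Re_sqrD hs)// (Re_sqrZ hs)// (ReZr hs)// -/K.
  rewrite addrC phiD// phiZ// Re_add conj_realC Re_mulC.
  have ti0 : 0 < t^-1 by rewrite invr_gt0.
  have := Re_amgm hs spos ti0 Wd Wh; rewrite invrK (hformBl hs)// Re_sub -/K.
  have : t^-1 * Re (s (u n - w) (u n - w)) < t.
    by rewrite -(ltr_pM2l t0) mulrA divff ?gt_eqF// mul1r.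
  have : Re (s w h - phi h) = - (t * (2 + 2 * K)).
    by rewrite /t divfK ?gt_eqF// opprK.
  have := Ju n; rewrite /J; move: neg; rewrite Re_sub.
  move: hn1; set y := n.+1%:R^-1; set X := t^-1 * _.
  set A := Re (s (u n) (u n)); set B := Re (s (u n) h); set D := Re (s w h).
  set P := Re (phi h); set Q := Re (phi (u n)).
  move=> yt neg Jn tE Xt am inf_le.
  have : t * (- (t + t * K)) < t * (2 * (B - P)) by lra.
  by rewrite ltr_pM2l//; lra.
move=> v Wv; have Viv : W ('i%C *: v) by exact: subspaceZ.
have full h : W h -> Re (s w h - phi h) = 0.
  move=> Wh; apply/eqP; rewrite eq_le half// andbT.
  have := half _ (subspaceN sW Wh); rewrite -scaleN1r phiZ// (hformZr hs)//.
  by rewrite -mulrBr rmorphN1 mulN1r Re_opp oppr_ge0.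
apply/eqP; rewrite -subr_eq0; apply/eqP; apply: complex_eq0P; first exact: full.
have := full _ Viv; rewrite (hformZr hs)// phiZ// -mulrBr.
have -> : ('i%C : R[i])^*%R = - 'i%C.
  by rewrite conj_conjc; apply/eqP; rewrite eq_complex /= oppr0 !eqxx.
by rewrite mulNr Re_opp => /eqP; rewrite oppr_eq0 => /eqP.
Qed.

End Riesz.

(** * The Dirichlet problem *)

Section DirichletProblem.
Variables (R : realType) (H : completeNormedModType R[i]).
Variables (dot a : H -> H -> R[i]) (H1 H01 : set H).
Local Notation Re := (@complex.Re R).
Hypothesis hdot : hform [set: H] dot.
Hypothesis dot_norm : forall u, dot u u = `|u| ^+ 2.
Hypothesis a_form : closed_positive_form dot H1 a.
Hypothesis H01_closed : form_closed_subspace H1 a H01.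

Lemma form_hform : hform H1 a.
Proof. by case: a_form => sV _ lin herm _ _; split. Qed.
Let ha := form_hform.

Let H01_sub : H01 `<=` H1. Proof. by case: H01_closed. Qed.

Let sH01 : is_subspace H01. Proof. by case: H01_closed. Qed.

Lemma dot_Re u : Re (dot u u) = Re `|u| ^+ 2.
Proof.
rewrite dot_norm; have := normr_ge0 u; rewrite lecE /= => /andP[/eqP].
by case: `|u| => x y /= -> _; rewrite !expr2 /= mul0r subr0.
Qed.

Lemma dot_pos u : [set: H] u -> u != 0 -> 0 < Re (dot u u).
Proof.
move=> _; rewrite -normr_gt0 => u0; rewrite dot_Re exprn_gt0//.
by have : (0 : R[i]) < `|u| := u0; rewrite ltcE => /andP[].
Qed.

Lemma form_lower : exists2 c : R, 0 < c &
  forall u, H1 u -> c * Re (dot u u) <= Re (a u u).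
Proof.
case: a_form => _ _ _ _ [c c0 ca] _; exists c => // u /ca.
by rewrite lecE Re_mulC => /andP[].
Qed.

Lemma form_ge0 u : H1 u -> 0 <= Re (a u u).
Proof.
have [c c0 ca] := form_lower; move=> /ca; apply: le_trans.
by apply: mulr_ge0; [exact: ltW|rewrite dot_Re sqr_ge0].
Qed.

Lemma normr_lt_dot u (e : R) : 0 < e -> Re (dot u u) < e ^+ 2 -> `|u| < e%:C%C.
Proof.
move=> e0; rewrite dot_Re.
have n0 : (0 : R[i]) <= `|u| := normr_ge0 u.
move: n0; rewrite lecE => /andP[/eqP im re].
rewrite ltr_pXn2r ?nnegrE ?(ltW e0)// => lt.
have : (`|u| : R[i]) < e%:C%C by rewrite ltcE im lt /= eqxx.
by [].
Qed.

Lemma dot_cauchy_cvg (u : nat -> H) :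
  (forall e, 0 < e -> exists N, forall m n, (N <= m)%N -> (N <= n)%N ->
     Re (dot (u m - u n) (u m - u n)) < e) ->
  exists w : H, u @ \oo --> w.
Proof.
move=> cau; apply/cvg_ex; apply/cauchy_cvgP/cauchy_exP => e e0.
have eE : e = (Re e)%:C%C.
  by move: (gtr0_real e0) => /complex_realP[k ->].
have r0 : 0 < Re e by move: e0; rewrite ltcE => /andP[].
have [N uN] := cau _ (exprn_gt0 2 r0).
exists (u N); exists N => // n /= Nn.
rewrite -ball_normE /= eE; apply: normr_lt_dot => //.
exact: uN.
Qed.

(** Coercivity makes the sequence Cauchy in [H]. Closedness of the form turns the limit in [H] into
    a limit for [a], which stays in the closed subspace [H01]. *)
Lemma form_complete (u : nat -> H) : (forall n, H01 (u n)) ->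
  (forall e, 0 < e -> exists N, forall m n, (N <= m)%N -> (N <= n)%N ->
     Re (a (u m - u n) (u m - u n)) < e) ->
  exists2 w, H01 w & forall e, 0 < e -> exists N, forall n, (N <= n)%N ->
     Re (a (u n - w) (u n - w)) < e.
Proof.
move=> Du cau; have H1u n := H01_sub (Du n).
have sH1 := hform_subspace ha.
have [c c0 ca] := form_lower.
have [|w uw] := @dot_cauchy_cvg u.
  move=> e e0; have [N uN] := cau _ (mulr_gt0 c0 e0); exists N => m n Nm Nn.
  rewrite -(ltr_pM2l c0); apply: le_lt_trans (uN _ _ Nm Nn).
  by apply: ca; exact: subspaceB.
case: a_form => _ _ _ _ _ /(_ u H1u) closed.
have [|H1w cw] := closed _ w uw.
  move=> e /cau[N uN]; exists N => m n Nm Nn.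
  by rewrite (hform_real ha) ?ltcR ?uN//; exact: subspaceB.
exists w; first by case: H01_closed => _ _ /(_ u w Du H1w); apply.
move=> e /cw[N uN]; exists N => n /uN.
by rewrite (hform_real ha) ?ltcR//; exact: subspaceB.
Qed.

Section SpectralPart.
Variables (E : set R -> H -> H) (hE : projection_valued_measure [set: H] dot E).
Variables (L : set R) (mL : measurable L).
Let D : set H := [set u | H01 u /\ E L u = u].

(** Convergence for [a] dominates convergence in [H], where the spectral projections are
    contractions, so the limit keeps its spectral support. *)
Lemma form_complete_part (u : nat -> H) : (forall n, D (u n)) ->
  (forall e, 0 < e -> exists N, forall m n, (N <= m)%N -> (N <= n)%N ->
     Re (a (u m - u n) (u m - u n)) < e) ->
  exists2 w, D w & forall e, 0 < e -> exists N, forall n, (N <= n)%N ->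
     Re (a (u n - w) (u n - w)) < e.
Proof.
move=> Du cau; have H01u n := (Du n).1.
have [w Hw uw] := form_complete H01u cau; exists w => //; split => //.
have sH1 := hform_subspace ha; have [c c0 ca] := form_lower.
have mC := measurableC mL.
apply: (pvm_compl_fix hdot dot_pos hE) => //.
apply: (pd_eq0_small hdot dot_pos) => // d d0.
have [N /(_ N (leqnn N)) uN] := uw _ (mulr_gt0 c0 d0).
have -> : E (~` L) w = E (~` L) (w - u N).
  by rewrite (pvmB hdot hE)// (pvm_disj hE mL mC _ (Du N).2) ?setICr ?subr0.
apply: le_trans (pvm_sqr_le hdot dot_pos hE mC _) _ => //.
rewrite -[w - u N]opprB (hformNl hdot)// (hformNr hdot)// opprK.
rewrite -(ler_pM2l c0); apply: ltW; apply: le_lt_trans uN.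
by apply: ca; apply: subspaceB => //; exact: H01_sub.
Qed.

Lemma part_subspace : is_subspace D.
Proof.
split; first by split; [exact: subspace0|exact: (pvm0 hdot hE)].
move=> z u v [Hu Eu] [Hv Ev]; split; first exact: subspaceP.
by rewrite (pvm_linear hE)// Eu Ev.
Qed.

Lemma solve_part (s : H -> H -> R[i]) (th C lam : R) x : hform D s ->
  0 < th -> 0 < C ->
  (forall v, D v -> th * Re (a v v) <= Re (s v v) <= C * Re (a v v)) -> H1 x ->
  exists2 w, D w & forall v, D v -> s w v = a x v - lam%:C%C * dot x v.
Proof.
move=> hs th0 C0 bnd H1x; have sD := hform_subspace hs.
have DH1 v : D v -> H1 v by move=> [/H01_sub].
have sH1 := hform_subspace ha; have [c c0 ca] := form_lower.
have spos v : D v -> 0 <= Re (s v v).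
  move=> Dv; have /andP[+ _] := bnd _ Dv; apply: le_trans.
  by apply: mulr_ge0; [exact: ltW|apply: form_ge0; exact: DH1].
(* Half of the coercivity absorbs [a x v], the other half [lam * dot x v]; the factor [c] in [t']
   passes from [dot v v] to [a v v]. *)
pose t : R := th / 2; have t0 : 0 < t by rewrite divr_gt0.
have ti0 : 0 < t^-1 by rewrite invr_gt0.
pose t' : R := c * t; have t'0 : 0 < t' by rewrite mulr_gt0.
have ti'0 : 0 < t'^-1 by rewrite invr_gt0.
pose y : H := (- lam)%:C%C *: x.
have aph z v : dot (((- lam)%:C%C : R[i]) *: z) v = - (lam%:C%C * dot z v).
  by rewrite (hformZl hdot)// rmorphN mulNr.
pose K := t^-1 * Re (a x x) + t'^-1 * Re (dot y y).
have bound v : D v ->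
    2 * Re (a x v - lam%:C%C * dot x v) <= Re (s v v) + K.
  move=> Dv; have Hv := DH1 _ Dv.
  have -> : a x v - lam%:C%C * dot x v = a x v + dot y v by rewrite aph.
  have am1 := Re_amgm ha form_ge0 ti0 H1x Hv.
  have am2 := Re_amgm hdot (fun w Vw => pd_ge0 hdot dot_pos Vw) ti'0
    (I : [set: H] y) (I : [set: H] v).
  rewrite !invrK in am1 am2.
  have /andP[sv _] := bnd _ Dv.
  have dv : t' * Re (dot v v) <= t * Re (a v v).
    by rewrite /t' mulrAC mulrC ler_pM2l// ca.
  rewrite Re_add /K mulrDr.
  have : th * Re (a v v) = t * Re (a v v) + t * Re (a v v).
    by rewrite -mulrDl /t -splitr.
  by lra.
apply: (riesz hs spos _ _ bound).
- move=> u Du cau; have [|w Dw uw] := form_complete_part Du.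
    move=> e e0; have [N uN] := cau _ (mulr_gt0 th0 e0); exists N => m n Nm Nn.
    rewrite -(ltr_pM2l th0); apply: le_lt_trans (uN _ _ Nm Nn).
    by have /andP[] := bnd _ (subspaceB sD (Du m) (Du n)).
  exists w => // e e0; have [N uN] := uw _ (divr_gt0 e0 C0); exists N => n Nn.
  have /andP[_ le] := bnd _ (subspaceB sD (Du n) Dw); apply: le_lt_trans le _.
  by rewrite -ltr_pdivlMl// mulrC uN.
- move=> z u v Du Dv; have Hu := DH1 _ Du; have Hv := DH1 _ Dv.
  have Hzu := subspaceZ sH1 z Hu.
  rewrite (hformDr ha)// (hformZr ha)// (hformDr hdot)// (hformZr hdot)//.
  by ring.
Qed.

End SpectralPart.
End DirichletProblem.

(** * From spectral gaps to coercivity *)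

Section CoercivityConstants.
Variables (R : realType) (l d c A B : R).

(** In these estimates [A] is [a[v]], [B] is the squared norm of [v] and [l] is [lam]. A gap
    measured by [B] becomes a bound by a multiple of [A]. *)
Lemma coercive_below : 0 < d -> 0 <= B -> A <= (l - d) * B ->
  d / (`|l| + 1) * A <= l * B - A.
Proof.
move=> d0 B0 h; have n0 := normr_ge0 l; have l1 : 0 < `|l| + 1 by lra.
have nl := ler_norm l; rewrite mulrAC ler_pdivrMr//.
have h2 : A <= (`|l| + 1) * B.
  by apply: le_trans h _; apply: ler_wpM2r => //; lra.
have h3 : d * A <= d * ((`|l| + 1) * B) by rewrite ler_pM2l.
apply: le_trans h3 _; rewrite mulrCA mulrC ler_pM2r//; lra.
Qed.

Lemma coercive_above : 0 < d -> 0 <= A -> 0 <= B -> (l + d) * B <= A ->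
  d / (`|l| + d) * A <= A - l * B.
Proof.
move=> d0 A0 B0 h; have n0 := normr_ge0 l; have l1 : 0 < `|l| + d by lra.
rewrite mulrAC ler_pdivrMr//; case: (ger0P l) => hl.
- by have : 0 <= l * (A - (l + d) * B); [rewrite mulr_ge0// subr_ge0|lra].
- have l0 : 0 <= - l by lra.
  have := mulr_ge0 l0 A0; have := mulr_ge0 (mulr_ge0 l0 l0) B0.
  have := mulr_ge0 (mulr_ge0 l0 (ltW d0)) B0; lra.
Qed.

Lemma form_shift_bound : 0 < c -> 0 <= A -> 0 <= B -> c * B <= A ->
  `|A - l * B| <= (`|l| / c + 1) * A.
Proof.
move=> c0 A0 B0 cB.
have h : `|l| * B <= `|l| / c * A.
  by rewrite mulrAC ler_pdivlMr// -mulrA ler_wpM2l// mulrC.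
have h1 : `|l * B| <= `|l| * B by rewrite normrM (ger0_norm B0).
move: h1; rewrite !ler_norml => /andP[h1 h2]; apply/andP; split; lra.
Qed.

End CoercivityConstants.

(** * Spectral splitting of [H01] at [lam] *)

Section DirichletGap.
Variables (R : realType) (H : completeNormedModType R[i]).
Variables (dot a : H -> H -> R[i]) (H1 H01 : set H).
Local Notation Re := (@complex.Re R).
Hypothesis hdot : hform [set: H] dot.
Hypothesis dot_norm : forall u, dot u u = `|u| ^+ 2.
Hypothesis a_form : closed_positive_form dot H1 a.
Hypothesis H01_closed : form_closed_subspace H1 a H01.
Variables (E : set R -> H -> H).
Hypothesis hT : spectral_measure [set: H] dot E (form_op dot H01 a).
Variables (lam d : R).
Hypothesis d0 : 0 < d.
Hypothesis gap : forall u, E (`]lam - d, lam + d[ `\ lam) u = 0.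
Let hE := sm_pvm hT.
Let ha := form_hform a_form.
Let dpos := dot_pos dot_norm.
Let H01_sub : H01 `<=` H1. Proof. by case: H01_closed. Qed.
Let sH01 : is_subspace H01. Proof. by case: H01_closed. Qed.
Let ha0 : hform H01 a. Proof. exact: hform_sub ha _ _. Qed.

Definition shifted_form u v := a u v - lam%:C%C * dot u v.
Local Notation q := shifted_form.

Lemma shifted_hform : hform H1 q.
Proof. by apply: hformB => //; apply: hform_sub hdot _ _ => //; case: ha. Qed.
Let hq := shifted_hform.
Let hq0 : hform H01 q. Proof. exact: hform_sub hq _ _. Qed.

Lemma Re_shifted u : Re (q u u) = Re (a u u) - lam * Re (dot u u).
Proof. by rewrite /q Re_sub Re_mulC. Qed.

Lemma form_op_lin V : hform V a -> forall c u f v g,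
  form_op dot V a u f -> form_op dot V a v g ->
  form_op dot V a (c *: u + v) (c *: f + g).
Proof.
move=> hV c u f v g [Vu uf] [Vv vg]; have sV := hform_subspace hV.
split=> [|w Vw]; first exact: subspaceP.
have Vcu := subspaceZ sV c Vu.
rewrite (hformDl hdot)// (hformZl hdot)// uf// vg//.
by rewrite (hformDl hV)// (hformZl hV).
Qed.
Let Tlin := form_op_lin ha0.

Let TW u f : form_op dot H01 a u f -> H01 u /\ forall v, H01 v ->
  dot f v = a u v.
Proof. by []. Qed.

Let lb0 u : H01 u -> 0 * Re (dot u u) <= Re (a u u).
Proof. by move=> /H01_sub Hu; rewrite mul0r;
  exact: (form_ge0 dot_norm a_form). Qed.

Let WV : H01 `<=` [set: H]. Proof. by []. Qed.

Let Lm : set R := `]-oo, lam[%classic.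
Let Lp : set R := `]lam, +oo[%classic.
Let L0 : set R := [set lam].
Let mLm : measurable Lm. Proof. exact: measurable_itv. Qed.
Let mLp : measurable Lp. Proof. exact: measurable_itv. Qed.
Let mL0 : measurable L0. Proof. exact: measurable_set1. Qed.
Let mgap : measurable (`]lam - d, lam + d[ `\ lam : set R).
Proof. exact: measurableD. Qed.
Let d2 : 0 < d / 2. Proof. by rewrite divr_gt0. Qed.

(** Cutting at [lam - d / 2] leaves out [[lam - d / 2, lam[], which lies inside the punctured open
    interval where [E] vanishes. *)
Lemma spectral_below_op u : E Lm u = u ->
  exists2 f, form_op dot H01 a u f &
    Re (a u u) <= (lam - d / 2) * Re (dot u u).
Proof.
move=> uE.
have mM : measurable (`]-oo, lam - d / 2[ : set R) by [].
have mC := measurableC mM.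
have uM : E `]-oo, lam - d / 2[ u = u.
  apply: (pvm_compl_fix hdot dpos hE) => //.
  rewrite -uE -(pvm_setI hE)//.
  have mI : measurable (~` `]-oo, lam - d / 2[ `&` Lm : set R).
    exact: measurableI.
  have wE := pvm_idem hE mI (I : setT u).
  rewrite -[LHS](pvm_sub hE mI mgap _ wE) ?gap//.
  move=> t /= [] /=; rewrite /Lm /= !in_itv /= => /negP;
    rewrite -leNgt => t1 t2.
  have d2' := d2; split; last by apply/eqP; rewrite lt_eqF.
  by apply/andP; split; lra.
have [f Tuf fu] := op_dom_below hdot dpos hT WV TW lb0 (I : setT u) uM.
exists f => //; have [->|u0] := eqVneq u 0.
  have V0 := subspace0 sH01.
  by rewrite (hform0l ha0)// (hform0l hdot)// mulr0.
by rewrite -(TW Tuf).2 ?ltW ?fu//; exact: (TW Tuf).1.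
Qed.

Lemma spectral_above_form u : H01 u -> E Lp u = u ->
  (lam + d / 2) * Re (dot u u) <= Re (a u u).
Proof.
move=> Hu uE.
have mM : measurable (`[lam + d / 2, +oo[ : set R) by [].
have mC := measurableC mM.
apply: (form_ge_above hdot dpos hT WV ha0 Tlin TW lb0 Hu).
apply: (pvm_compl_fix hdot dpos hE) => //.
rewrite -uE -(pvm_setI hE)//.
have mI : measurable (~` `[lam + d / 2, +oo[ `&` Lp : set R).
  exact: measurableI.
have wE := pvm_idem hE mI (I : setT u).
rewrite -[LHS](pvm_sub hE mI mgap _ wE) ?gap//.
move=> t /= [] /=; rewrite /Lp /= !in_itv /= !andbT => /negP;
  rewrite -ltNge => t1 t2.
have d2' := d2; split; last by apply/eqP; rewrite gt_eqF.
by apply/andP; split; lra.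
Qed.

Lemma spectral_at_op u : E L0 u = u -> exists f, form_op dot H01 a u f.
Proof.
move=> uE; apply: (op_dom_bounded hdot dpos hT mL0 (lexx lam) _ (I : setT u)
  uE).
by move=> t ->; rewrite lexx.
Qed.

Lemma spectral_split u :
  u = E Lm u + (E L0 u + E Lp u).
Proof.
have -> : E L0 u + E Lp u = E (~` Lm) u.
  rewrite -(pvm_setU hdot dpos hE mL0 mLp) //.
    congr (E _ u); apply/seteqP; split=> t;
      rewrite /L0 /Lm /Lp /= !in_itv /= andbT.
      by case=> [->|/ltW]; rewrite ?ltxx// leNgt => /negP.
    by move=> /negP; rewrite -leNgt le_eqVlt => /predU1P[->|]; [left|right].
  by rewrite -subset0 => t [->]; rewrite /Lp /= in_itv /= ltxx.
exact: (pvm_compl hdot dpos hE mLm).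
Qed.

Lemma shifted_orth x f y L M : measurable L -> measurable M ->
  form_op dot H01 a x f -> H01 y -> E L x = x -> E M y = y ->
  L `&` M = set0 -> q x y = 0.
Proof.
move=> mL mM Txf Hy Lx My LM; rewrite /q.
rewrite (op_form_cross hdot dpos hT WV ha0 Tlin TW mL mM Txf Hy Lx My LM).
by rewrite (pvm_orth hdot hE mL mM _ _ Lx My LM)// mulr0 subrr.
Qed.

(* [q u u] vanishes on the range of [E L0], hence so does [q] by polarization. *)
Lemma spectral_at_kernel u : E L0 u = u -> H01 u /\ forall v, H01 v ->
  q u v = 0.
Proof.
move=> uE; have [f Tuf] := spectral_at_op uE; have Hu := (TW Tuf).1.
have null w : E L0 w = w -> H01 w /\ Re (q w w) = 0.
  move=> wE; have bnd t : L0 t -> lam <= t <= lam by move=> ->; rewrite lexx.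
  have [Hw /andP[h1 h2]] :=
    op_form_bounds hdot dpos hT WV TW mL0 (lexx lam) bnd (I : setT w) wE.
  by split=> //; rewrite Re_shifted; apply/eqP; rewrite subr_eq0 eq_le h1 h2.
split=> // v Hv; have mC := measurableC mL0.
set v0 := E L0 v; have v0E : E L0 v0 = v0 := pvm_idem hE mL0 (I : setT v).
have [Hv0 qv0] := null _ v0E.
have v1E := pvm_idem hE mC (I : setT v).
have v1D : E (~` L0) v = v - v0.
  by rewrite [in RHS](pvm_compl hdot dpos hE mL0 (I : setT v)) -/v0 addrC addKr.
rewrite v1D in v1E.
have Hv1 : H01 (v - v0) by exact: subspaceB.
have -> : v = v0 + (v - v0) by rewrite addrC subrK.
rewrite (hformDr hq0)// (shifted_orth mL0 mC Tuf Hv1 uE v1E) ?setICr// addr0.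
have half w : E L0 w = w -> Re (q w v0) = 0.
  move=> wE; have [Hw qw] := null _ wE.
  have [|_] := null (w + v0); first by rewrite (pvmD hE)// wE v0E.
  by rewrite (Re_sqrD hq0)// qw qv0 add0r addr0 => /eqP;
    rewrite mulf_eq0 pnatr_eq0 => /eqP.
apply: (hform_eq0_Re hq0) => //; first exact: half.
by apply: half; rewrite (pvmZ hdot hE)// uE.
Qed.

(** The equation is solved separately below and above [lam], where [- q] and [q] are equivalent to
    [a]. At [lam] both sides vanish, the right one by hypothesis on [x], and the parts do not
    interact. *)
Lemma dirichlet_solve x : H1 x ->
  (forall k, H01 k -> (forall v, H01 v -> q k v = 0) -> q x k = 0) ->
  exists2 w, H01 w & forall v, H01 v -> q w v = q x v.
Proof.
move=> H1x xK; have sH1 := hform_subspace ha.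
have [c c0 ca] := form_lower a_form.
pose D L : set H := [set u | H01 u /\ E L u = u].
have sD L : measurable L -> is_subspace (D L).
  by move=> mL; exact: (part_subspace hdot H01_closed hE mL).
have DH1 L : D L `<=` H1 by move=> u [/H01_sub].
pose C := `|lam| / c + 1.
have C0 : 0 < C by rewrite ltr_wpDl// divr_ge0// ltW.
have an u (Hu : H01 u) := form_ge0 dot_norm a_form (H01_sub Hu).
have dn u := pd_ge0 hdot dpos (I : setT u).
have shb u (Hu : H01 u) :=
  form_shift_bound lam c0 (an _ Hu) (dn u) (ca _ (H01_sub Hu)).
have l1 : 0 < `|lam| + 1 by rewrite ltr_wpDl.
have l2 : 0 < `|lam| + d / 2 by rewrite ltr_wpDl.
have hDm : hform (D Lm) (fun u v => - q u v).
  by apply: hformN; apply: hform_sub hq _ _; [exact: sD|exact: DH1].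
have hDp : hform (D Lp) q by apply: hform_sub hq _ _; [exact: sD|exact: DH1].
have bm v : D Lm v -> (d / 2) / (`|lam| + 1) * Re (a v v) <= Re (- q v v) <=
    C * Re (a v v).
  move=> [Hv vE]; have [_ _ vlt] := spectral_below_op vE.
  rewrite Re_opp Re_shifted opprB coercive_below//=.
  by apply: le_trans (shb _ Hv); rewrite -opprB -normrN ler_norm.
have bp v : D Lp v -> (d / 2) / (`|lam| + d / 2) * Re (a v v) <= Re (q v v) <=
    C * Re (a v v).
  move=> [Hv vE]; have vgt := spectral_above_form Hv vE.
  rewrite Re_shifted coercive_above ?an//=.
  by apply: le_trans (shb _ Hv); rewrite ler_norm.
(* The positive form below [lam] is [- q], so the data are taken from [- x]. *)
have [wm [Hwm wmE] wmq] := solve_part hdot dot_norm a_form H01_closed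
  hE mLm lam hDm (divr_gt0 d2 l1) C0 bm (subspaceN sH1 H1x).
have [wp [Hwp wpE] wpq] := solve_part hdot dot_norm a_form H01_closed
  hE mLp lam hDp (divr_gt0 d2 l2) C0 bp H1x.
have [fm Tm _] := spectral_below_op wmE.
exists (wm + wp); first exact: subspaceD.
move=> v Hv; have Hv' := H01_sub Hv.
set vm := E Lm v; have vmE : E Lm vm = vm := pvm_idem hE mLm (I : setT v).
set v0 := E L0 v; have v0E : E L0 v0 = v0 := pvm_idem hE mL0 (I : setT v).
set vp := E Lp v; have vpE : E Lp vp = vp := pvm_idem hE mLp (I : setT v).
have vs : v = vm + (v0 + vp) := spectral_split v.
have [gm Tvm _] := spectral_below_op vmE; have Hvm := (TW Tvm).1.
have [Hv0 v0K] := spectral_at_kernel v0E.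
(* The parts below and at [lam] lie in the operator domain, but the part above need not; it is in
   [H01] as a difference. *)
have Hvp : H01 vp.
  have -> : vp = v - vm - v0 by rewrite {1}vs [X in X - v0]addrC addKr addrC
    addKr.
  by apply: subspaceB => //; exact: subspaceB.
have [g0 Tv0] := spectral_at_op v0E.
have dmp : Lm `&` Lp = set0.
  rewrite -subset0 => t []; rewrite /Lm /Lp /= !in_itv /= andbT => t1 t2.
  by have := lt_trans t1 t2; rewrite ltxx.
have qxm : q wm vm = q x vm.
  have := wmq vm (conj Hvm vmE).
  rewrite (hformNl ha)// ?(hformNl hdot)//; last exact: H01_sub.
  by rewrite mulrN -opprD => /oppr_inj.
have qx0 : q x v0 = 0 by exact: xK.
have qv0 u : H01 u -> q u v0 = 0.
  by move=> Hu; rewrite (hformC hq0 Hv0 Hu) v0K ?rmorph0.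
have qmp : q wm vp = 0 := shifted_orth mLm mLp Tm Hvp wmE vpE dmp.
have qpm : q wp vm = 0.
  rewrite (hformC hq0 Hvm Hwp).
  by rewrite (shifted_orth mLm mLp Tvm Hwp vmE wpE dmp) rmorph0.
have Hv0p : H01 (v0 + vp) by exact: subspaceD.
rewrite {1}vs (hformDl hq0)// ?(hformDr hq0)//; last exact: subspaceD.
rewrite qxm !qv0// qmp qpm {1}(wpq vp (conj Hvp vpE)).
rewrite [in RHS]vs (hformDr hq)//; try exact: H01_sub.
rewrite (hformDr hq)//; try exact: H01_sub.
by rewrite qx0 !add0r !addr0.
Qed.

End DirichletGap.

(** * Isolation of a point below the essential spectrum *)

Section EssentialSpectrum.
Variables (R : realType) (H : completeNormedModType R[i]).
Variables (dot : H -> H -> R[i]).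
Local Notation Re := (@complex.Re R).
Hypothesis hdot : hform [set: H] dot.
Hypothesis dot_norm : forall u, dot u u = `|u| ^+ 2.

Lemma norm_realC (x : R) : `|x%:C%C : R[i]| = `|x|%:C%C.
Proof. by rewrite normc_def /= expr0n addr0 sqrtr_sqr. Qed.

Lemma normr_Re (u : H) : `|u| = (Re `|u|)%:C%C.
Proof.
have := normr_ge0 u; rewrite lecE /= => /andP[/eqP].
by case: `|u| => x y /= -> _.
Qed.

Lemma Re_normr_ge0 (u : H) : 0 <= Re `|u|.
Proof. by have := normr_ge0 u; rewrite lecE /= => /andP[]. Qed.

Lemma resolvent_bound (T : H -> H -> Prop) (x : R) : resolvent_set T x%:C%C ->
  exists2 M : R, 0 <= M & forall u f, T u (f + x%:C%C *: u) ->
    Re (dot u u) <= M * Re (dot f f).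
Proof.
move=> [_ [M TM]]; exists (Re M ^+ 2); first exact: sqr_ge0.
move=> u f /TM; rewrite (normr_Re u) (normr_Re f) !(dot_Re dot_norm).
rewrite mulrC lecE => /andP[_] /=; rewrite Re_mulC mulrC => uf.
rewrite -exprMn ler_pXn2r ?nnegrE ?Re_normr_ge0//.
exact: le_trans (Re_normr_ge0 u) uf.
Qed.

Lemma dimE_zero (K : set H) : (forall u, K u -> u = 0) -> (dimE K < +oo)%E.
Proof.
move=> K0; apply: (@le_lt_trans _ _ (0%:E : \bar R)%E); last exact: ltry.
apply: ge_ereal_sup => _ [[|n] [f Kf lf] <-] //.
have := lf (fun i => (i == ord0)%:R).
rewrite big1 => [/(_ erefl ord0)/eqP|i _]; first by rewrite eqxx oner_eq0.
by rewrite (K0 _ (Kf i)) scaler0.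
Qed.

Section Gap.
Variables (W : set H) (p : H -> H -> R[i]) (E : set R -> H -> H).
Hypothesis hp : hform W p.
Hypothesis hT : spectral_measure [set: H] dot E (form_op dot W p).
Hypothesis Tlin : forall c u f v g, form_op dot W p u f ->
  form_op dot W p v g -> form_op dot W p (c *: u + v) (c *: f + g).
Let hE := sm_pvm hT.
Let dpos := dot_pos dot_norm.
Let T := form_op dot W p.

Let TW u f : T u f -> W u /\ forall v, W v -> dot f v = p u v.
Proof. by []. Qed.

Let WV : W `<=` [set: H]. Proof. by []. Qed.

Lemma form_op_resolvent_gap (x : R) : resolvent_set T x%:C%C ->
  exists2 d, 0 < d & forall u, [set: H] u -> E `]x - d, x + d[ u = 0.
Proof.
move=> /resolvent_bound[M M0 TM].
exact: (resolvent_gap hdot dpos hT WV hp Tlin TW M0 TM).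
Qed.

(** Either [lam] is in the resolvent set, and a full neighbourhood is null, or it is a discrete
    spectral point. Then it is isolated, each nearby point has a resolvent gap, and [punctured_gap]
    assembles them. *)
Lemma form_op_gap (lam : R) : (lam%:E < ess_bottom T)%E ->
  (exists2 d, 0 < d & forall u, E (`]lam - d, lam + d[ `\ lam) u = 0) /\
  (dimE (Defs.eigenspace T lam%:C%C) < +oo)%E.
Proof.
move=> lt.
have ness : ~ ess_spectrum T lam%:C%C.
  move=> ess; move: lt; rewrite ltNge => /negP[].
  by apply: ereal_inf_lbound; exists lam.
have [res|spec] := pselect (resolvent_set T lam%:C%C).
  have [d d0 dE] := form_op_resolvent_gap res; split.
    exists d => // u.
    have mA : measurable (`]lam - d, lam + d[ `\ lam : set R) by exact:
      measurableD.
    have wE := pvm_idem hE mA (I : setT u).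
    by rewrite -[LHS](pvm_sub hE mA (measurable_itv _) _ wE (M :=
      `]lam - d, lam + d[%classic)) ?dE// => t [].
  apply: dimE_zero => u Tu; have [/(_ 0)[w [Tw uniq]] _] := res.
  rewrite -(uniq u); last by rewrite add0r.
  apply: uniq; rewrite scaler0 addr0; have W0 := subspace0 (hform_subspace hp).
  split=> // v Wv; rewrite (hform0l hp)//; exact: (hform0l hdot).
have [_ [e e0 eT] _ fin] : discrete_spectrum T lam%:C%C.
  by apply: contra_notP ness => nd; exact: (conj spec nd).
split=> //.
have eE : e = (Re e)%:C%C.
  by move: (gtr0_real e0) => /complex_realP[k ->].
have r0 : 0 < Re e by move: e0; rewrite ltcE => /andP[].
exists (Re e) => // u.
apply: (punctured_gap hdot dpos hT _ (I : setT u)) => //.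
move=> y /andP[y0 ye]; apply: form_op_resolvent_gap.
have [//|spec'] := pselect (resolvent_set T y%:C%C).
have : y%:C%C = lam%:C%C :> R[i].
  by apply: eT => //; rewrite -rmorphB /= norm_realC eE ltcR.
by move=> /complexI yl; move: y0; rewrite yl subrr normr0 ltxx.
Qed.

End Gap.

(** [Re_amgm] at [c^* *: w] and [z], where [c = dot w z]. The added 1 lets the weight be inverted
    when [w = 0]. *)
Lemma cauchy_schwarz_shift (w z : H) :
  `|dot w z| ^+ 2 <= ((Re (dot w w) + 1) * Re (dot z z))%:C%C.
Proof.
set c := dot w z; have dpos := dot_pos dot_norm.
have ge0 u (Hu : [set: H] u) := pd_ge0 hdot dpos Hu.
have w1 : 0 < Re (dot w w) + 1 by rewrite ltr_wpDl// ge0.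
have wi : 0 < (Re (dot w w) + 1)^-1 by rewrite invr_gt0.
have := Re_amgm hdot ge0 wi (I : setT (c^*%R *: w)) (I : setT z).
rewrite invrK (Re_sqrZ_norm hdot)// (hformZl hdot)// -/c.
have -> : c^*%R * c = `|c| ^+ 2 by rewrite mulrC normCK.
rewrite norm_conjC -add_Re2_Im2 /= Re_mulC => am.
rewrite lecR; set N := _ + _ in am *.
have N0 : 0 <= N by rewrite addr_ge0 ?sqr_ge0.
have : (Re (dot w w) + 1)^-1 * (N * Re (dot w w)) <= N.
  by rewrite ler_pdivrMl// mulrC ler_wpM2r//; lra.
by lra.
Qed.

Lemma dot_continuous (w : H) : continuous (fun v => dot w v : R[i]^o).
Proof.
move=> v; apply/cvgrPdist_lt => e e0.
have eE : e = (Re e)%:C%C.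
  by move: (gtr0_real e0) => /complex_realP[k ->].
have r0 : 0 < Re e by move: e0; rewrite ltcE => /andP[].
have dpos := dot_pos dot_norm.
(* Since [K >= 1], one has [K <= K ^+ 2], so the radius [Re e / K] suffices without a square
   root. *)
set K := Re (dot w w) + 1.
have K1 : 1 <= K by rewrite lerDr (pd_ge0 hdot dpos).
have K0 : 0 < K by exact: lt_le_trans K1.
have d0 : (0 : R[i]) < (Re e / K)%:C%C by rewrite ltcR divr_gt0.
near=> u.
have : `|v - u| < (Re e / K)%:C%C.
  by near: u; apply: (@cvgr_dist_lt _ _ _ _ _ id) => //; exact: cvg_id.
rewrite (normr_Re (v - u)) ltcR => vu.
rewrite -(hformBr hdot)// eE.
rewrite -(ltr_pXn2r (n := 2))// ?nnegrE ?lecR ?(ltW r0)//.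
apply: le_lt_trans (cauchy_schwarz_shift _ _) _.
rewrite -rmorphXn /= ltcR -/K (dot_Re dot_norm).
have -> : Re e ^+ 2 = (K * (Re e / K)) ^+ 2 by rewrite mulrCA divff ?mulr1
  ?gt_eqF.
rewrite exprMn; apply: (@lt_le_trans _ _ (K * (Re e / K) ^+ 2)).
  by rewrite ltr_pM2l// ltr_pXn2r ?nnegrE ?Re_normr_ge0 ?ltW ?divr_gt0.
by rewrite ler_wpM2r ?sqr_ge0// expr2 ler_peMl// ltW.
Unshelve. all: by end_near. Qed.

End EssentialSpectrum.

(** * Common eigenvectors and the Neumann side *)

Section CommonEigenvectors.
Variables (R : realType) (H : completeNormedModType R[i]).
Variables (dot a : H -> H -> R[i]) (H1 H01 : set H) (lam : R).
Local Notation Re := (@complex.Re R).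
Hypothesis hdot : hform [set: H] dot.
Hypothesis dot_norm : forall u, dot u u = `|u| ^+ 2.
Hypothesis a_form : closed_positive_form dot H1 a.
Hypothesis H01_closed : form_closed_subspace H1 a H01.
Let ha := form_hform a_form.
Let dpos := dot_pos dot_norm.
Let H01_sub : H01 `<=` H1. Proof. by case: H01_closed. Qed.
Let sH01 : is_subspace H01. Proof. by case: H01_closed. Qed.
Let sH1 : is_subspace H1. Proof. by case: ha. Qed.
Local Notation q := (shifted_form dot a lam).
Let hq := shifted_hform hdot a_form lam.

Definition kernelD : set H := [set k | H01 k /\ forall v, H01 v -> q k v = 0].
Definition kernelDN : set H := [set k | H01 k /\ forall v, H1 v -> q k v = 0].
(** With [kernelD] as [K] and [kernelDN] as [K_0], this is the space [K_1]. *)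
Definition kernelD_orth : set H :=
  [set k | kernelD k /\ forall k0, kernelDN k0 -> dot k k0 = 0].

Lemma form_op_eigen V : V `<=` H1 -> forall u, V u ->
  form_op dot V a u (lam%:C%C *: u) <-> forall v, V v -> q u v = 0.
Proof.
move=> VH u Vu; split=> [[_ uE] v Vv|uE].
  by rewrite /shifted_form -uE// (hformZl hdot)// subrr.
split=> // v Vv; have := uE _ Vv; rewrite /shifted_form (hformZl hdot)//.
by move=> /eqP; rewrite subr_eq0 => /eqP.
Qed.

Lemma eigenspace_kernelD :
  Defs.eigenspace (form_op dot H01 a) lam%:C%C = kernelD.
Proof.
apply/seteqP; split=> u; rewrite /Defs.eigenspace /= => uE.
  by split; [case: uE|apply/form_op_eigen => //; case: uE].
by case: uE => Hu uE; apply/form_op_eigen.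
Qed.

Lemma q_kernel_subspace V : V `<=` H1 ->
  is_subspace [set k | H01 k /\ forall v, V v -> q k v = 0].
Proof.
move=> VH; split=> [|c u v [Hu qu] [Hv qv]].
  split=> [|v /VH Hv]; [exact: subspace0|exact: (hform0l hq)].
split=> [|w Vw]; first exact: subspaceP.
have Hw := VH _ Vw; have Hcu := subspaceZ sH01 c Hu.
rewrite (hformDl hq) ?(hformZl hq)//; try exact: H01_sub.
by rewrite qu// qv// mulr0 addr0.
Qed.

Lemma kernelD_subspace : is_subspace kernelD.
Proof. exact: q_kernel_subspace. Qed.

Lemma kernelDN_subspace : is_subspace kernelDN.
Proof. exact: q_kernel_subspace. Qed.

Lemma kernelDN_sub : kernelDN `<=` kernelD.
Proof. by move=> k [Hk qk]; split=> // v /H01_sub; exact: qk. Qed.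

Lemma kernelD_orth_subspace : is_subspace kernelD_orth.
Proof.
have sK := kernelD_subspace; split=> [|c u v [Ku du] [Kv dv]].
  by split=> [|k _]; [exact: subspace0|exact: (hform0l hdot)].
split=> [|k Kk]; first exact: subspaceP.
by rewrite (hformDl hdot)// (hformZl hdot)// du// dv// mulr0 addr0.
Qed.

(** A maximal family for [- dot] is an orthonormal basis of [K], since the form is definite; the two
    signs in [p] cancel. *)
Lemma finite_dim_orthoproj (K : set H) x : is_subspace K ->
  (dimE K < +oo)%E -> exists p, is_orthoproj dot K x p.
Proof.
move=> sK; have ht := hformN hdot.
have hK : hform K (fun u v => - dot u v) by exact: hform_sub ht _ _.
have tneg y : [set: H] y -> y != 0 -> Re (- dot y y) < 0.
  by move=> _ y0; rewrite Re_opp oppr_lt0 dpos.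
rewrite (dimE_neg_sizes hK) => [|y _]; last exact: tneg.
case: (neg_sizes_cases K (fun u v => - dot u v)) => [[n [[e ne] max _]]|[_ ->]];
  last by rewrite ltxx.
move=> _; have neT : neg_family [set: H] (fun u v => - dot u v) n e.
  by split=> //; exact: ne.2.
set p := - \sum_(i < n) (- dot x (e i)) *: e i.
have [_ xe] := neg_family_project ht neT (I : setT x).
have Kp : K p.
  by apply: subspaceN => //; apply: subspace_sum => // i; exact: ne.1.
exists p; split=> // k Kk.
have [Kk1 k1e] := neg_family_project hK ne Kk.
set k1 := k + _ in Kk1 k1e.
have k10 : k1 = 0.
  have [//|/(tneg _ I)] := eqVneq k1 0.
  by rewrite ltNge (neg_family_max hK ne max).
have -> : k = - \sum_(i < n) (- dot k (e i)) *: e i.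
  by apply/eqP; rewrite -addr_eq0; apply/eqP.
rewrite (hformNr hdot)// (hformC hdot (I : setT (\sum_(i < n) _)))//.
rewrite (hform_suml hdot)// big1 ?rmorph0 ?oppr0// => i _.
rewrite (hformC hdot (I : setT (x - p)))//.
have := xe _ (ltn_ord i); rewrite /p opprK => /eqP; rewrite oppr_eq0 => /eqP ->.
by rewrite rmorph0 mulr0.
Qed.

Lemma dimE_le (K L : set H) : K `<=` L -> (dimE K <= dimE L)%E.
Proof.
move=> KL; apply: le_ereal_sup => _ [n [f Kf lf] <-]; exists n => //.
by exists f => // i; exact: KL.
Qed.

Lemma kernelD_split k : (dimE kernelD < +oo)%E -> kernelD k ->
  exists2 k0, kernelDN k0 & kernelD_orth (k - k0).
Proof.
move=> fin Kk.
have [|k0 [Kk0 orth]] := finite_dim_orthoproj k kernelDN_subspace.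
  exact: le_lt_trans (dimE_le kernelDN_sub) fin.
exists k0 => //; split; last exact: orth.
by apply: subspaceB => //; [exact: kernelD_subspace|exact: kernelDN_sub].
Qed.

(** Both eigenvalues of [f] agree and are real. If they equal [lam], then [f] is in [kernelDN];
    otherwise [k] and [f] satisfy the eigenvalue equation of [A_D] for distinct values. *)
Lemma common_eigenvector_orth k f : kernelD_orth k ->
  eigenvector (form_op dot H1 a) f -> eigenvector (form_op dot H01 a) f ->
  dot k f = 0.
Proof.
move=> [[Hk qk] orth] [f0 [z [H1f zf]]] [_ [z' [Hf zf']]].
have ff0 : dot f f != 0.
  by apply: contraTneq (dpos (I : setT f) f0) => ->; rewrite ltxx.
have zaf : z * dot f f = a f f by rewrite -zf// (hformZl hdot).
have zz' : z' = z.
  by apply: (mulIf ff0); rewrite zaf -zf'// (hformZl hdot).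
have zreal : z^*%R = z.
  apply: (mulIf ff0); rewrite zaf [RHS](hformC ha)// -zaf rmorphM /=.
  by rewrite -(hformC hdot).
have [zl|zl] := eqVneq z lam%:C%C.
  apply: orth; split=> // v Hv.
  by rewrite /shifted_form -zf// (hformZl hdot)// zl subrr.
have kf : lam%:C%C * dot k f = z * dot k f.
  have /eqP := qk _ Hf; rewrite /shifted_form subr_eq0 => /eqP <-.
  rewrite (hformC ha)//; last exact: H01_sub.
  rewrite -zf'// (hformZl hdot)// zz' rmorphM /= zreal.
  by rewrite -(hformC hdot).
have /eqP : (lam%:C%C - z) * dot k f = 0 by rewrite mulrBl kf subrr.
by rewrite mulf_eq0 subr_eq0 eq_sym (negbTE zl) => /eqP.
Qed.

(** Projecting keeps the pairings with [kernelDN], whose nonzero elements are common eigenvectors.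
    Conversely [kernelD_orth] is already contained in [calH], whatever the eigenvalue, and each of
    its vectors is its own projection. *)
Lemma orthoproj_calH : orthoproj_image dot kernelD (calH dot H1 H01 a) =
  kernelD_orth.
Proof.
apply/seteqP; split=> [p [h hH [Kp hp]]|k Kk].
  split=> // k0 Kk0; have := hp _ (kernelDN_sub Kk0).
  rewrite (hformBl hdot)// => /eqP; rewrite subr_eq0 => /eqP <-.
  have [->|k00] := eqVneq k0 0; first exact: (hform0r hdot).
  apply: hH; exists 1%N, (fun=> 1), (fun=> k0); split; last first.
    by rewrite big_ord1 scale1r.
  have [Hk0 qk0] := Kk0; move=> _; split; split=> //; exists lam%:C%C.
  - by apply/form_op_eigen => //; exact: H01_sub.
  - by apply/form_op_eigen => // v /H01_sub; exact: qk0.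
exists k; last by split; [case: Kk|move=> v _; rewrite subrr (hform0l hdot)].
move=> _ [n [c [f [fe ->]]]].
rewrite (hformC hdot (I : setT (\sum_(i < n) _)))// (hform_suml hdot)//.
rewrite big1 ?rmorph0// => i _; rewrite (hformC hdot (I : setT k))//.
by have [? ?] := fe i; rewrite (common_eigenvector_orth Kk)// rmorph0 mulr0.
Qed.

End CommonEigenvectors.

(** * The space [G] and the operator [B_op] *)

Section Neumann.
Variables (R : realType) (H : completeNormedModType R[i]).
Variables (dot a : H -> H -> R[i]) (H1 H01 : set H) (lam : R).
Local Notation Re := (@complex.Re R).
Hypothesis hdot : hform [set: H] dot.
Hypothesis dot_norm : forall u, dot u u = `|u| ^+ 2.
Hypothesis a_form : closed_positive_form dot H1 a.
Hypothesis H01_closed : form_closed_subspace H1 a H01.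
Let ha := form_hform a_form.
Let dpos := dot_pos dot_norm.
Let H01_sub : H01 `<=` H1. Proof. by case: H01_closed. Qed.
Let sH01 : is_subspace H01. Proof. by case: H01_closed. Qed.
Let sH1 : is_subspace H1. Proof. by case: ha. Qed.
Local Notation q := (shifted_form dot a lam).
Let hq := shifted_hform hdot a_form lam.

(** The continuity required by [H1_A] is automatic: on [H01] the functional [a u] agrees with
    [dot (lam *: u)]. *)
Lemma G_orth : G dot H1 H01 a lam = [set u | H1 u /\ forall v, H01 v ->
  q u v = 0].
Proof.
apply/seteqP; split=> u; rewrite /G /Defs.eigenspace /A_max /H1_A /=.
  move=> [[Hu _] uE]; split=> // v Hv.
  by rewrite /shifted_form -uE// (hformZl hdot)// subrr.
move=> [Hu qu]; have uE v : H01 v -> dot (lam%:C%C *: u) v = a u v.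
  move=> Hv; have /eqP := qu _ Hv; rewrite /shifted_form subr_eq0 => /eqP ->.
  by rewrite (hformZl hdot).
split=> //; split=> //.
apply: (@subspace_eq_continuous _ _ _ (fun v => dot (lam%:C%C *: u) v :
  R[i]^o)).
  by move=> v /set_mem; exact: uE.
exact/continuous_subspaceT/dot_continuous.
Qed.

Lemma G_subspace : is_subspace (G dot H1 H01 a lam).
Proof.
rewrite G_orth; split=> [|c u v [Hu qu] [Hv qv]].
  split=> [|v /H01_sub Hv]; [exact: subspace0|exact: (hform0l hq)].
split=> [|w Hw]; first exact: subspaceP.
have Hcu := subspaceZ sH1 c Hu; have H1w := H01_sub Hw.
by rewrite (hformDl hq)// (hformZl hq)// qu// qv// mulr0 addr0.
Qed.

Lemma G_sub : G dot H1 H01 a lam `<=` H1.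
Proof. by rewrite G_orth => u []. Qed.

(** Against [v] in [G] the projection drops out, and [a g v = dot u v] because [g] is the preimage
    of [u] under [A_N]. *)
Lemma B_op_form u w : B_op dot H1 H01 a lam u w ->
  G dot H1 H01 a lam u /\ forall v, G dot H1 H01 a lam v -> a w v = q u v.
Proof.
move=> [Gu [g [p [[H1g gu] [Gp gp] ->]]]]; split=> // v Gv.
have Hp := G_sub Gp; have Hv := G_sub Gv; have Hu := G_sub Gu.
have Hlp := subspaceZ sH1 lam%:C%C Hp.
rewrite (hformBl ha)// (hformZl ha)// /shifted_form gu//.
have := gp _ Gv; rewrite (hformBl ha)// => /eqP.
by rewrite subr_eq0 => /eqP ->.
Qed.

Lemma B_op_lin c u f v g : B_op dot H1 H01 a lam u f ->
  B_op dot H1 H01 a lam v g -> B_op dot H1 H01 a lam (c *: u + v) (c *: f + g).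
Proof.
move=> [Gu [g1 [p1 [Ag1 [Gp1 pp1] ->]]]] [Gv [g2 [p2 [Ag2 [Gp2 pp2] ->]]]].
have sG := G_subspace.
split; first exact: subspaceP.
exists (c *: g1 + g2), (c *: p1 + p2); split.
- exact: form_op_lin.
- split=> [|w Gw]; first exact: subspaceP.
  have Hp1 := G_sub Gp1; have Hp2 := G_sub Gp2; have Hw := G_sub Gw.
  have [[Hg1 _] [Hg2 _]] := (Ag1, Ag2).
  have H12 := subspaceB sH1 Hg1 Hp1; have H22 := subspaceB sH1 Hg2 Hp2.
  have -> : c *: g1 + g2 - (c *: p1 + p2) = c *: (g1 - p1) + (g2 - p2).
    by rewrite scalerBr opprD addrACA.
  have Hc := subspaceZ sH1 c H12.
  by rewrite (hformDl ha)// (hformZl ha)// pp1// pp2// mulr0 addr0.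
- by rewrite scalerBr scalerDr opprD addrACA !scalerA mulrC.
Qed.

End Neumann.

Lemma dot_hform (R : realType) (H : lmodType R[i]) (dot : {dot H for Num.conj})
  :
  hform [set: H] dot.
Proof.
split=> [|c u v w _ _ _|u v _ _]; first by split.
  by rewrite linearPl.
by rewrite hermC expr0 mul1r.
Qed.

Unset Implicit Arguments.

Theorem theorem1p7 (R : realType) (H : completeNormedModType R[i])
  (dot : {dot H for Num.conj})
  (dot_norm : forall u : H, dot u u = `|u| ^+ 2)
  (H_infinite : dimE [set: H] = +oo%E)
  (H_separable : exists2 S : set H, countable S & dense S)
  (H1 : set H) (a : H -> H -> R[i])
  (a_form : closed_positive_form dot H1 a)
  (H01 : set H)
  (H01_closed : form_closed_subspace H1 a H01)
  (H01_dense : dense H01)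
  (E_N E_D : set R -> H -> H)
  (E_N_spec : spectral_measure [set: H] dot E_N (A_N dot H1 a))
  (E_D_spec : spectral_measure [set: H] dot E_D (A_D dot H01 a))
  (lam : R)
  (lam_lt : (lam%:E < ess_bottom (A_D dot H01 a))%E)
  (E_B : set R -> H -> H)
  (E_B_spec : spectral_measure (G dot H1 H01 a lam) a E_B
                (B_op dot H1 H01 a lam)) :
  counting_function E_N lam =
    (counting_function E_D lam + n_D dot H1 H01 a lam
     + dimE (E_B [set` `]-oo, 0%R[] @` G dot H1 H01 a lam))%E.
Proof.
have hdot := dot_hform dot.
have dpos := dot_pos dot_norm.
have ha := form_hform a_form.
have [c c0 ca] := form_lower a_form.
have a_ge0 := form_ge0 dot_norm a_form.
have [sD DV _] := H01_closed.
have haD : hform H01 a by exact: hform_sub ha _ _.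
have hq := shifted_hform hdot a_form lam.
have linN := form_op_lin hdot ha.
have linD := form_op_lin hdot haD.
have lbN u : H1 u -> 0 * complex.Re (dot u u) <= complex.Re (a u u).
  by rewrite mul0r; exact: a_ge0.
have lbD u : H01 u -> 0 * complex.Re (dot u u) <= complex.Re (a u u).
  by move=> /DV; exact: lbN.
have subT (V : set H) : V `<=` [set: H] by [].
have indexN : counting_function E_N lam =
    sup_size R (neg_sizes H1 (shifted_form dot a lam)).
  exact/esym/(glazman hdot dpos E_N_spec (subT H1) ha linN (fun _ _ => id) lbN).
have indexD : counting_function E_D lam =
    sup_size R (neg_sizes H01 (shifted_form dot a lam)).
  exact/esym/(glazman hdot dpos E_D_spec (subT H01) haD linD (fun _ _ => id)
    lbD).
have GH1 : G dot H1 H01 a lam `<=` H1 by exact: G_sub hdot dot_norm.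
have sG := G_subspace lam hdot dot_norm a_form H01_closed.
have indexB : dimE (E_B [set` `]-oo, 0%R[] @` G dot H1 H01 a lam) =
    sup_size R (neg_sizes (G dot H1 H01 a lam) (shifted_form dot a lam)).
  have haG : hform (G dot H1 H01 a lam) a by exact: hform_sub ha _ _.
  have hqG : hform (G dot H1 H01 a lam) (shifted_form dot a lam).
    by exact: hform_sub hq _ _.
  have apos u : G dot H1 H01 a lam u -> u != 0 -> 0 < complex.Re (a u u).
    move=> /GH1 /ca cu u0; apply: lt_le_trans cu.
    by rewrite mulr_gt0// dpos.
  (* [q] may be negative on [G]; [form_shift_bound] bounds it below relative to [a], using
     coercivity of [a]. *)
  have lbB u : G dot H1 H01 a lam u -> - (`|lam| / c + 1) * complex.Re (a u u)
    <=
      complex.Re (shifted_form dot a lam u u).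
    move=> /GH1 Hu; rewrite Re_shifted.
    have := form_shift_bound lam c0 (a_ge0 _ Hu) (pd_ge0 hdot dpos I) (ca _ Hu).
    by rewrite ler_norml mulNr => /andP[].
  rewrite -(glazman haG apos E_B_spec (@subset_refl _ _) hqG _ _ lbB);
    last 2 first.
  - exact: B_op_lin.
  - exact: B_op_form.
  congr (sup_size _ (neg_sizes _ _)); apply/funext => u; apply/funext => v.
  by rewrite mul0r subr0.
have [[d d0 gap] fin] := form_op_gap hdot dot_norm haD E_D_spec linD lam_lt.
rewrite (eigenspace_kernelD lam hdot H01_closed) in fin.
have nD : n_D dot H1 H01 a lam = dimE (kernelD_orth dot a H1 H01 lam).
  rewrite /n_D -(orthoproj_calH lam hdot dot_norm a_form H01_closed).
  by rewrite -(eigenspace_kernelD lam hdot H01_closed).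
rewrite indexN indexD indexB nD (G_orth a H1 H01 lam hdot dot_norm).
have htV : hform H1 (fun u v => - dot u v).
  by apply: hform_sub (hformN hdot) _ _ => //; case: ha.
apply: (index_theorem hq htV) => //.
- by move=> u _ u0; rewrite Re_opp oppr_lt0 dpos.
- exact: (kernelD_orth_subspace lam hdot a_form H01_closed).
- by move=> k [[]].
- by move=> k [[Hk qk] _]; split=> //; exact: DV.
(* A vector of [K_1] that pairs to zero with all of [H1] is in [K_0], hence orthogonal to itself. *)
- move=> k [[Hk qk] orth] k0; apply: contrapT => no_dual.
  have kN : kernelDN dot a H1 H01 lam k.
    split=> // v Hv; apply: contrapT => /eqP qkv; apply: no_dual.
    exists v => //; rewrite (hformC hq (DV _ Hk) Hv).
    by rewrite fmorph_eq0.
  by have := dpos k I k0; rewrite (orth _ kN) ltxx.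
- move=> x Hx xK.
  apply: (dirichlet_solve hdot dot_norm a_form H01_closed E_D_spec d0 gap Hx).
  (* [x] is known to be orthogonal to [K_1] only; the [K_0] component [k1] of [k] is orthogonal to
     all of [H1]. *)
  move=> k Hk qk.
  have [k1 [Hk1 qk1] kk1] := kernelD_split hdot dot_norm a_form H01_closed fin
    (conj Hk qk).
  have -> : k = (k - k1) + k1 by rewrite subrK.
  have Vk := DV _ Hk; have Vk1 := DV _ Hk1.
  rewrite (hformDr hq)//; last by apply: subspaceB => //; case: ha.
  by rewrite xK// add0r (hformC hq Vk1 Hx) qk1// rmorph0.
- by apply: le_lt_trans fin; apply: dimE_le => k [].
Qed.
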